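(* Let $M=\mathbb{R}^5_s/\Gamma$ be a complete homogeneous flat pseudo-Riemannian manifold of dimension $5$ (with $5-s\geq s$). Then $\Gamma$ is a free abelian group. Depending on the signature of $M$, we have the following possibilities: (1) Signature $(5,0)$ or $(4,1)$: $\Gamma$ is a group of pure translations. (2) Signature $(3,2)$: $\Gamma$ is either a group of pure translations, or there exists $(I+A,v)\in\Gamma$ with $A\neq 0$. In the latter case, $\mathrm{rk}\,\Gamma\leq 3$, and if $\gamma_1,\ldots,\gamma_k$ with $\gamma_i=(I+A_i,v_i)$ and $k=\mathrm{rk}\,\Gamma\in\{1,2,3\}$ are generators of $\Gamma$ such that $A_1\neq 0$, then $v_1,\ldots,v_k$ are linearly independent, and, in a Witt basis with respect to $U_\Gamma$ (for which $\dim U_\Gamma=2$), each $\gamma_i$ has the form $$\gamma_i=\left(\begin{pmatrix} I_2 & 0 & C_i \\ 0 & 1 & 0 \\ 0 & 0 & I_2 \end{pmatrix},\begin{pmatrix} u_i \\ w_i \\ 0 \end{pmatrix}\right),\qquad C_i=\begin{pmatrix} 0 & c_i \\ -c_i & 0 \end{pmatrix},\quad c_i\in\mathbb{R},\ u_i\in\mathbb{R}^2,\ w_i\in\mathbb{R},$$ with $w_i=\frac{c_i}{c_1}w_1$ for $i=1,\ldots,k$.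
   Context: $\mathbb{R}^n_s$ denotes $\mathbb{R}^n$ with a non-degenerate symmetric bilinear form $\langle\cdot,\cdot\rangle$ of signature $(n-s,s)$, with $n-s\geq s$, and $\mathrm{Iso}(\mathbb{R}^n_s)$ is its group of (affine) isometries. Affine maps are written $\gamma=(I+A,v)$, with linear part $I+A$ and translation part $v$. ''$M=\mathbb{R}^n_s/\Gamma$ is a complete homogeneous flat pseudo-Riemannian manifold'' means that $\Gamma\subset\mathrm{Iso}(\mathbb{R}^n_s)$ acts freely and properly discontinuously and the isometry group of $M$ acts transitively on $M$ (equivalently, the centralizer of $\Gamma$ in $\mathrm{Iso}(\mathbb{R}^n_s)$ acts transitively on $\mathbb{R}^n_s$). Set $U_\Gamma=\sum_{(I+A,v)\in\Gamma}\mathrm{im}\,A$. For a totally isotropic subspace $U$ of dimension $k$, a Witt basis with respect to $U$ is a basis $u_1,\ldots,u_k,w_1,\ldots,w_{n-2k},u_1^*,\ldots,u_k^*$ of $\mathbb{R}^n_s$ such that $u_1,\dots,u_k$ is a basis of $U$, the $w_j$ form a basis of a non-degenerate subspace $W$ with $U^\perp=U\oplus W$, and $u_1^*,\dots,u_k^*$ is a basis of a totally isotropic subspace $U^*$ orthogonal to $W$ with $\langle u_i,u_j^*\rangle=\delta_{ij}$. *)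

(* Defs.v *)
From HB Require Import structures.
From mathcomp Require Import all_boot all_order all_algebra.
From mathcomp Require Import all_classical all_reals all_analysis.
Set Implicit Arguments.
Unset Strict Implicit.
Unset Printing Implicit Defensive.
Import Order.TTheory GRing.Theory Num.Theory.
Import numFieldNormedType.Exports.
Local Open Scope classical_set_scope.
Local Open Scope ring_scope.

Section BilinearForm.
Variables (R : realType) (n : nat).

(* The bilinear form on R^n with Gram matrix Q. *)
Definition form (Q : 'M[R]_n) (x y : 'cV[R]_n) : R := (x^T *m Q *m y) 0 0.

Definition std_gram (s : nat) : 'M[R]_n :=
  diag_mx (\row_(i < n) if (i < n - s)%N then 1 else -1).

(* Signature (n - s, s), in the sense of Sylvester's law of inertia.  A matrix
   congruent to std_gram s is automatically symmetric and non-degenerate. *)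
Definition has_signature (Q : 'M[R]_n) (s : nat) : Prop :=
  exists2 P : 'M[R]_n, P \in unitmx & P^T *m Q *m P = std_gram s.

Definition totally_isotropic (Q : 'M[R]_n) (U : {vspace 'cV[R]_n}) : Prop :=
  forall x y, x \in U -> y \in U -> form Q x y = 0.

Definition nondegenerate_on (Q : 'M[R]_n) (W : {vspace 'cV[R]_n}) : Prop :=
  forall x, x \in W -> (forall y, y \in W -> form Q x y = 0) -> x = 0.

Definition in_orthogonal (Q : 'M[R]_n) (U : {vspace 'cV[R]_n}) (x : 'cV[R]_n) :
  Prop := forall y, y \in U -> form Q x y = 0.

(* (u, w, us) is a Witt basis with respect to U; us is the family u_i^*.  Since
   u ++ w ++ us is a basis of R^n, one has m = n - 2k. *)
Record witt_basis (Q : 'M[R]_n) (U : {vspace 'cV[R]_n}) (k m : nat)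
    (u : k.-tuple 'cV[R]_n) (w : m.-tuple 'cV[R]_n) (us : k.-tuple 'cV[R]_n) :
    Prop := WittBasis {
  witt_isotropic : totally_isotropic Q U;
  witt_basis_full : basis_of fullv (u ++ w ++ us);
  witt_basis_U : basis_of U u;
  witt_nondegenerate : nondegenerate_on Q <<w>>%VS;
  witt_orthogonal : forall x, in_orthogonal Q U x <-> x \in (U + <<w>>)%VS;
  witt_direct : directv (U + <<w>>);
  witt_dual_isotropic : totally_isotropic Q <<us>>%VS;
  witt_dual_orthogonal :
    forall x y, x \in <<us>>%VS -> y \in <<w>>%VS -> form Q x y = 0;
  witt_dual : forall i j : 'I_k, form Q (tnth u i) (tnth us j) = (i == j)%:R
}.

(* The matrix whose columns are the vectors of e. *)
Definition basis_mx (e : n.-tuple 'cV[R]_n) : 'M[R]_n :=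
  \matrix_(i, j) tnth e j i 0.

End BilinearForm.

Section AffineMaps.
Variables (R : realType) (n : nat).

(* The pair (B, v) stands for the affine map x |-> B x + v; its linear part is
   B = I + A, so that A = B - 1%:M. *)
Definition aff : Type := ('M[R]_n * 'cV[R]_n)%type.

Definition aff_app (g : aff) (x : 'cV[R]_n) : 'cV[R]_n := g.1 *m x + g.2.

Definition aff_one : aff := (1%:M, 0).

(* aff_mul g h is the composite of g after h. *)
Definition aff_mul (g h : aff) : aff := (g.1 *m h.1, g.1 *m h.2 + g.2).

Definition aff_inv (g : aff) : aff := (invmx g.1, - (invmx g.1 *m g.2)).

(* The affine map g in the linear coordinates given by the columns of P. *)
Definition aff_in_basis (P : 'M[R]_n) (g : aff) : aff :=
  (invmx P *m g.1 *m P, invmx P *m g.2).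

Definition Iso (Q : 'M[R]_n) : set aff :=
  [set g | forall x y, form Q (g.1 *m x) (g.1 *m y) = form Q x y].

Definition is_subgroup (G : set aff) : Prop :=
  [/\ G aff_one,
      forall g h, G g -> G h -> G (aff_mul g h)
    & forall g, G g -> G (aff_inv g)].

Definition generates (k : nat) (g : 'I_k -> aff) (G : set aff) : Prop :=
  smallest is_subgroup (range g) = G.

(* The group G is isomorphic to the free abelian group on I, realized as the
   finitely supported functions from I to the integers. *)
Definition free_abelian_on (I : Type) (G : set aff) : Prop :=
  exists phi : (I -> int) -> aff,
    let Z_I := [set a : I -> int | finite_set [set i | a i <> 0]] in
    set_bij Z_I G phi /\
    forall a b, Z_I a -> Z_I b ->
      phi (fun i => a i + b i) = aff_mul (phi a) (phi b).

Definition free_abelian (G : set aff) : Prop :=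
  exists I : Type, free_abelian_on I G.

Definition free_abelian_of_rank (G : set aff) (k : nat) : Prop :=
  free_abelian_on 'I_k G.

Definition acts_freely (G : set aff) : Prop :=
  forall g x, G g -> aff_app g x = x -> g = aff_one.

Definition acts_properly_discontinuously (G : set aff) : Prop :=
  forall K : set 'cV[R]_n, compact K ->
    finite_set [set g | G g /\ (aff_app g @` K) `&` K !=set0].

Definition orbit (G : set aff) (x : 'cV[R]_n) : set 'cV[R]_n :=
  [set aff_app g x | g in G].

(* The points of the quotient M = R^n / G. *)
Definition quotient (G : set aff) : set (set 'cV[R]_n) := range (orbit G).

(* An isometry of the flat manifold M: a bijection of M that lifts, near every
   point of R^n, to an isometry of R^n_s.  The projection to M is a local
   isometry, and a local isometry between connected open subsets of R^n_s is
   the restriction of an element of Iso Q. *)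
Definition quotient_isometry (Q : 'M[R]_n) (G : set aff)
    (f : set 'cV[R]_n -> set 'cV[R]_n) : Prop :=
  set_bij (quotient G) (quotient G) f /\
  forall x : 'cV[R]_n, exists2 g, Iso Q g &
    \forall z \near x, f (orbit G z) = orbit G (aff_app g z).

Definition homogeneous_quotient (Q : 'M[R]_n) (G : set aff) : Prop :=
  forall p q, quotient G p -> quotient G q ->
    exists2 f, quotient_isometry Q G f & f p = q.

Record complete_homogeneous_flat (Q : 'M[R]_n) (G : set aff) : Prop :=
    CompleteHomogeneousFlat {
  chf_isometries : G `<=` Iso Q;
  chf_subgroup : is_subgroup G;
  chf_free : acts_freely G;
  chf_properly_discontinuous : acts_properly_discontinuously G;
  chf_homogeneous : homogeneous_quotient Q G
}.

Definition pure_translations (G : set aff) : Prop :=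
  forall g, G g -> g.1 = 1%:M.

(* U_G, the sum of the images of A over all (I + A, v) in G. *)
Definition U_sum (G : set aff) : set 'cV[R]_n :=
  [set x | exists (m : nat) (g : 'I_m -> aff) (y : 'I_m -> 'cV[R]_n),
     (forall i, G (g i)) /\ x = \sum_i ((g i).1 - 1%:M) *m y i].

End AffineMaps.

Section NormalForm.
Variable R : realType.

Definition skew2 (c : R) : 'M[R]_2 :=
  \matrix_(i, j) if (i == 0) && (j == 1) then c
                 else if (i == 1) && (j == 0) then - c else 0.

(* The affine map with linear part [I_2, 0, C; 0, 1, 0; 0, 0, I_2], where
   C = [0, c; -c, 0], and translation part (u, w, 0). *)
Definition normal_form (c : R) (u : 'cV[R]_2) (w : R) : aff R (2 + (1 + 2)) :=
  (block_mx 1%:M (row_mx 0 (skew2 c)) 0 (block_mx 1%:M 0 0 1%:M),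
   col_mx u (col_mx w%:M 0)).

End NormalForm.

(* Main.v *)
From Pilot Require Import Defs.
From HB Require Import structures.
From mathcomp Require Import all_boot all_order all_algebra.
From mathcomp Require Import all_classical all_reals all_analysis.
From mathcomp Require Import ring zify.
Set Implicit Arguments.
Unset Strict Implicit.
Unset Printing Implicit Defensive.
Import Order.TTheory GRing.Theory Num.Theory.
Import numFieldNormedType.Exports.
Local Open Scope classical_set_scope.
Local Open Scope ring_scope.

(** The homogeneity of M lifts to a transitive group N of isometries of R^n
    normalizing G: a quotient isometry lifts near each point, and two local
    lifts differ by an element of G, because countably many proper affine
    subspaces cannot cover an open set.  For c, d in G the displacements
    satisfy <c x - x, d x - x> = <c' 0, d' 0>, where c', d' are the conjugates
    by an element of N taking 0 to x; as G is countable, this polynomial in x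
    takes countably many values, so it is constant.  In the same way, a linear
    relation between the displacements of c and d which holds at one point
    holds everywhere.

    Constancy says that the linear parts I + A have A skew, with isotropic
    image and A v = 0, and that different A's anticommute.  As isotropic
    subspaces have dimension at most s and nonzero skew maps have rank at least
    2, all A vanish when s <= 1; when s = 2 all nonzero A have the same
    2-dimensional image U, and every v lies in the orthogonal of U.  Hence
    g |-> v embeds G as a discrete subgroup of R^n. *)

(* MathComp-Analysis also exports a [form] and an [orbit]. *)
Local Notation form := Pilot.Defs.form.
Local Notation orbit := Pilot.Defs.orbit.

(** * Countability arguments for polynomials and affine equations *)

Section Countability.
Variable R : realType.

Lemma uncountable_itv (a b : R) : a < b -> ~ countable [set` `]a, b[].
Proof.
move=> ab /countable_lebesgue_measure0;
  rewrite lebesgue_measure_itv/= lte_fin ab.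
by rewrite -EFinB => -[] /eqP; rewrite subr_eq0 (gt_eqF ab).
Qed.

Lemma countable_roots (p : {poly R}) : p != 0 -> countable [set t | root p t].
Proof.
elim: (size p) {-2}p (leqnn (size p)) => [|m IH] {}p.
  by rewrite leqn0 size_poly_eq0 => ->.
move=> sp p0.
have [[t rt]|nr] := pselect (exists t, root p t); last first.
  suff -> : [set t | root p t] = set0 by exact: countable0.
  by apply/seteqP; split=> t //= rt; case: nr; exists t.
have /factor_theorem [q pq] := rt.
have q0 : q != 0 by apply: contraNneq p0; rewrite pq => ->; rewrite mul0r.
have -> : [set t | root p t] = [set t | root q t] `|` [set t].
  apply/seteqP; split=> u /=; rewrite pq rootM root_XsubC.
    by case/orP=> [|/eqP]; [left|right].
  by case=> [->|->]; rewrite ?eqxx ?orbT.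
rewrite -bigcup2E; apply: bigcup_countable => // -[|[|i]] //= _.
by apply: IH => //; move: sp;
  rewrite pq size_Mmonic ?monicXsubC// size_XsubC addn2.
Qed.

(** The parameters to avoid form a countable union of countable root sets, while an open interval is
    uncountable. *)
Lemma avoid_roots (I : Type) (D : set I) (p : I -> {poly R}) (e : R) :
    countable D -> (forall i, D i -> p i != 0) -> 0 < e ->
  exists t, [/\ 0 < t, t < e & forall i, D i -> (p i).[t] != 0].
Proof.
move=> cD p0 e0; apply: contrapT => nt.
apply: (uncountable_itv e0).
have : countable (\bigcup_(i in D) [set t | root (p i) t]).
  by apply: bigcup_countable => // i Di; apply: countable_roots; exact: p0.
apply: sub_countable; apply: subset_card_le => t /=;
  rewrite in_itv/= => /andP[t0 te].
apply: contrapT => nr; apply: nt; exists t; split=> // i Di.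
by apply/negP => rt; apply: nr; exists i.
Qed.

(** If p were not constant, every [p - v%:P] would be nonzero, and one t avoiding all their roots
    would give a value outside V. *)
Lemma countable_values_const (p : {poly R}) (V : set R) :
  countable V -> (forall t, V p.[t]) -> (size p <= 1)%N.
Proof.
move=> cV pV; rewrite leqNgt; apply/negP => sp.
have [v _|t [_ _ /(_ _ (pV t))]] :=
  @avoid_roots R V (fun v => p - v%:P) 1 cV _ ltr01.
- apply: contraTneq sp => /eqP; rewrite subr_eq0 => /eqP ->.
  by rewrite -leqNgt size_polyC leq_b1.
- by rewrite hornerD hornerN hornerC subrr eqxx.
Qed.

Variable n : nat.
Implicit Types (M : 'M[R]_n) (b x : 'cV[R]_n).

(* Restricted to the moment curve, a nonzero affine map has finitely many
   zeros. *)
Lemma affine_cover (I : Type) (D : set I) (M : I -> 'M[R]_n)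
    (b : I -> 'cV[R]_n) (z : 'cV[R]_n) :
    countable D ->
    (\forall x \near z, exists2 i, D i & M i *m x + b i = 0) ->
  exists2 i, D i & M i = 0 /\ b i = 0.
Proof.
move=> cD /nbhs_ballP [e /= e0 He]; apply: contrapT => nD.
pose c i := M i *m z + b i.
(* Row k of the affine map along [t |-> z + (t, t^2, ..., t^n)]: the constant coefficient is the
   value at z and the coefficient of degree l + 1 is the entry (k, l) of [M i]. The default 0 is
   never reached. *)
pose p i (k : 'I_n) : {poly R} := \poly_(j < n.+1)
  (if j is j'.+1 then (if insub j' is Some l then M i k l else 0) else c i k 0).
pose curve t : 'cV[R]_n := \col_j t ^+ j.+1.
have pE i k t : (p i k).[t] = (M i *m (z + curve t) + b i) k 0.
  rewrite mulmxDr addrAC -/(c i) mxE [(M i *m curve t) k 0]mxE.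
  rewrite horner_poly big_ord_recl expr0 mulr1; congr (_ + _).
  apply: eq_bigr => j _; rewrite !mxE /=; congr (_ * _).
  by rewrite valK.
have pn0 i : D i -> exists k, p i k != 0.
  move=> Di; apply: contrapT => np0; apply: nD; exists i => //.
  have p0 k : p i k = 0 by apply/eqP; apply: contrapT => /negP h; apply: np0;
    exists k.
  have M0 : M i = 0.
    apply/matrixP => k l; rewrite mxE.
    have := congr1 (fun q : {poly R} => q`_l.+1) (p0 k).
    by rewrite coef0 coef_poly ltnS ltn_ord /= valK.
  split=> //; apply/matrixP => k l; rewrite ord1 [RHS]mxE.
  have := congr1 (fun q : {poly R} => q`_0) (p0 k).
  by rewrite coef0 coef_poly /= /c M0 mul0mx add0r.
(* For t < 1 all the powers of t on the curve are at most t, so t < e keeps the point in the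
   ball. *)
pose e' := Num.min e 1.
have e'0 : 0 < e' by rewrite lt_min e0 ltr01.
have cD' : countable [set ik : I * 'I_n | D ik.1 /\ p ik.1 ik.2 != 0].
  have := countableX cD (countableP [set: 'I_n]); apply: sub_countable.
  by apply: subset_card_le => -[i k] [].
have [ik []//|t [t0 te' pt]] := avoid_roots (p :=
  fun ik => p ik.1 ik.2) cD' _ e'0.
have [] := He (z + curve t).
  split=> // i j; rewrite /ball /= !mxE opprD addNKr normrN normrX ger0_norm
    ?ltW//.
  apply: le_lt_trans (_ : t < e);
    last by rewrite (lt_le_trans te')// ge_min lexx.
  rewrite exprS ger_pMr//; apply: exprn_ile1; first exact: ltW.
  by rewrite ltW// (lt_le_trans te')// ge_min lexx orbT.
move=> i Di E0; have [k pk] := pn0 i Di.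
by have := pt (i, k) (conj Di pk); rewrite /= pE E0 mxE eqxx.
Qed.

End Countability.

(** * Composition of affine maps, and isometries as matrix identities *)

Section Affine.
Variables (R : realType) (n : nat).
Implicit Types (g h : aff R n) (x y : 'cV[R]_n) (Q B : 'M[R]_n).

Lemma aff_appM g h x : aff_app (aff_mul g h) x = aff_app g (aff_app h x).
Proof. by rewrite /aff_app /= mulmxDr mulmxA addrA. Qed.

Lemma aff_appV g x : g.1 \in unitmx -> aff_app (aff_inv g) (aff_app g x) = x.
Proof. by move=> gu; rewrite /aff_app /= mulmxDr mulKmx// addrK. Qed.

Lemma aff_appK g x : g.1 \in unitmx -> aff_app g (aff_app (aff_inv g) x) = x.
Proof.
by move=> gu; rewrite /aff_app /= mulmxDr mulKVmx// mulmxN mulKVmx// subrK.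
Qed.

Lemma aff_ext g h : (forall x, aff_app g x = aff_app h x) -> g = h.
Proof.
move=> gh; have e2 : g.2 = h.2 by have := gh 0; rewrite /aff_app !mulmx0 !add0r.
case: g h gh e2 => [A a] [B b] gh /= e2; rewrite e2; congr (_, _).
apply/matrixP => i j.
have := gh (delta_mx j 0); rewrite /aff_app /= e2 => /addIr.
by rewrite -!colE => /matrixP/(_ i 0); rewrite !mxE.
Qed.

Lemma formE Q x y : form Q x y = (x^T *m (Q *m y)) 0 0.
Proof. by rewrite /form mulmxA. Qed.

Lemma form_delta Q i j : form Q (delta_mx i 0) (delta_mx j 0) = Q i j.
Proof. by rewrite /form trmx_delta -rowE -colE !mxE. Qed.

Lemma formM Q B1 B2 x y :
  form Q (B1 *m x) (B2 *m y) = form (B1^T *m Q *m B2) x y.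
Proof. by rewrite /form trmx_mul !mulmxA. Qed.

Lemma form_inj Q1 Q2 : (forall x y, form Q1 x y = form Q2 x y) -> Q1 = Q2.
Proof. by move=> e; apply/matrixP => i j; rewrite -!form_delta. Qed.

Lemma Iso_gram Q g : Iso Q g -> g.1^T *m Q *m g.1 = Q.
Proof. by move=> gI; apply: form_inj => x y; rewrite -formM; exact: gI. Qed.

Lemma Iso_unit Q g : Q \in unitmx -> Iso Q g -> g.1 \in unitmx.
Proof.
move=> Qu /Iso_gram e; move: (Qu); rewrite -[in X in X -> _]e.
by rewrite unitmx_mul => /andP[].
Qed.

End Affine.

(** * Lifting isometries of the quotient to isometries normalizing G *)

Section Lift.
Variables (R : realType) (n : nat) (Q : 'M[R]_n) (G : set (aff R n)).
Hypothesis Qu : Q \in unitmx.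
Hypothesis GI : G `<=` Iso Q.
Hypothesis Gs : is_subgroup G.
Hypothesis Gpd : acts_properly_discontinuously G.
Implicit Types (g h : aff R n) (x y z : 'cV[R]_n).

Let Gu g : G g -> g.1 \in unitmx.
Proof. by move=> /GI; exact: Iso_unit. Qed.

Lemma box_compact (m : R) : compact [set x : 'cV[R]_n | forall i,
  `|x i 0| <= m].
Proof.
have rc := @rV_compact R n (fun=> `[- m,
  m]%classic) (fun=> @segment_compact R _ _).
have -> : [set x : 'cV[R]_n | forall i, `|x i 0| <= m] =
    trmx @` [set v : 'rV[R]_n | forall i, `[- m, m]%classic (v ord0 i)].
  apply/seteqP; split=> [x xm|_ [v vm <-] i] /=; last first.
    by rewrite mxE ler_norml; have := vm i; rewrite /= in_itv.
  exists x^T; last by rewrite trmxK.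
  by move=> i /=; rewrite in_itv/= mxE -ler_norml; exact: xm.
apply: continuous_compact rc; apply: continuous_subspaceT.
move=> v A /nbhs_ballP [e /= e0 Ae]; apply/nbhs_ballP; exists e => // w [_ vw].
by apply: Ae; split=> // i j; rewrite !mxE; exact: vw.
Qed.

(** Such an element takes 0 to its translation part, both in the box of radius m, so proper
    discontinuity on this compact box bounds their number. *)
Lemma finite_translations (m : R) :
  finite_set [set g | G g /\ forall i, `|g.2 i 0| <= m].
Proof.
(* For negative m the set is empty when n > 0; when n = 0 the bound is vacuous, but there is only
   one affine map. *)
have [m0|m0] := ltP m 0.
  have [n0|n0] := posnP n; last first.
    suff -> : [set g | G g /\ forall i, `|g.2 i 0| <= m] = set0 by [].
    apply/seteqP; split=> // g [_ /(_ (Ordinal n0))] gm.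
    by have := le_lt_trans gm m0; rewrite normr_lt0.
  apply: sub_finite_set (finite_set1 (aff_one R n)) => -[A a] _ /=.
  by congr (_, _); apply/matrixP => -[i i_lt]; exfalso; rewrite n0 in i_lt.
have := Gpd (@box_compact m); apply: sub_finite_set => g [Gg gm]; split=> //.
exists g.2; split=> //.
by exists 0; rewrite /aff_app ?mulmx0 ?add0r//= => i; rewrite mxE normr0.
Qed.

Lemma countable_group : countable G.
Proof.
have : countable (\bigcup_(m in [set: nat]) [set g | G g /\ forall i,
  `|g.2 i 0| <= m%:R]).
  apply: bigcup_countable => // m _; apply: finite_set_countable.
  exact: finite_translations.
apply: sub_countable; apply: subset_card_le => g Gg.
exists (Num.truncn `|g.2|).+1 => //=; split=> // i.
apply: le_trans (ltW (truncnS_gt _)).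
rewrite [leRHS]/Num.norm/= mx_normrE.
exact: (le_bigmax _ (fun ij : 'I_n * 'I_1 => `|g.2 ij.1 ij.2|) (i, 0)).
Qed.

Lemma orbit_eqP x y : orbit G x = orbit G y <-> exists2 h,
  G h & y = aff_app h x.
Proof.
have [G1 GM GV] := Gs; split=> [e|[h Gh ->]].
  have : orbit G y y by exists (aff_one R n) => //;
    rewrite /aff_app mul1mx addr0.
  by rewrite -e => -[h Gh <-]; exists h.
apply/seteqP; split=> _ [k Gk <-].
  exists (aff_mul k (aff_inv h)); first by apply: GM => //; exact: GV.
  by rewrite aff_appM aff_appV// Gu.
by exists (aff_mul k h); [exact: GM|rewrite aff_appM].
Qed.

(** Each z near z0 solves one of the equations [g' z = h (g z)] with h in G. These are countably
    many affine equations, so by [affine_cover] one of them is an identity. *)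
Lemma near_same_orbit g g' z0 :
    (\forall z \near z0, orbit G (aff_app g z) = orbit G (aff_app g' z)) ->
  exists2 h, G h & g' = aff_mul h g.
Proof.
move=> same.
have := @affine_cover R n _ G (fun h => g'.1 - h.1 *m g.1)
  (fun h => g'.2 - (aff_mul h g).2) z0 countable_group.
case.
  apply: filterS same => z /orbit_eqP[h Gh e]; exists h => //.
  rewrite mulmxBl addrACA -opprD [X in _ - X](_ : _ = aff_app (aff_mul h g)
    z)//.
  by rewrite aff_appM -e subrr.
move=> h Gh [/subr0_eq e1 /subr0_eq e2]; exists h => //.
by rewrite [LHS]surjective_pairing e1 e2.
Qed.

(** The local lift g at 0 works globally: the set U of points near which g lifts f is open, closed
    and contains 0, so it contains the segment from 0 to any y. *)
Lemma quotient_isometry_lift f : quotient_isometry Q G f ->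
  exists2 g, Iso Q g & forall z, f (orbit G z) = orbit G (aff_app g z).
Proof.
move=> [_ loc]; have [g gI g0] := loc 0; exists g => // y.
pose P z := f (orbit G z) = orbit G (aff_app g z).
pose U := interior P.
have Uop : open U by exact: open_interior.
(* At a limit point x of U, the local lift k of f at x and the map g both lift f near some x' in U,
   hence differ by an element of G; so g lifts f near x as well. *)
have Ucl : closed U.
  move=> x Ux; have [k kI kx] := loc x.
  have /Ux [x' [Ux' kx']] : nbhs x (interior [set z | f (orbit G z) = orbit G
    (aff_app k z)]).
    exact: nbhs_interior.
  have [h Gh ge] : exists2 h, G h & k = aff_mul h g.
    apply: (@near_same_orbit g k x'); near=> z.
    suff [<- <-] : P z /\ f (orbit G z) = orbit G (aff_app k z) by [].
    by split; near: z.
  apply: filterS kx => z; rewrite /P => ->.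
  by apply/esym/orbit_eqP; exists h => //; rewrite ge aff_appM.
have cont : continuous (fun t : R => t *: y) by move=> t;
  exact: scalel_continuous.
have E : `[0, 1]%classic `&` (fun t : R => t *: y) @^-1` U = `[0, 1]%classic.
  apply: (@segment_connected R 0 1).
  - by exists 0; split; rewrite /= ?in_itv/= ?lexx ?ler01// scale0r.
  - by exists ((fun t : R => t *: y) @^-1` U) => //; apply: open_comp.
  - by exists ((fun t : R => t *: y) @^-1` U) => //; apply: closed_comp.
have [_] : (`[0, 1]%classic `&` (fun t : R => t *: y) @^-1` U) 1.
  by rewrite E /= in_itv/= lexx ler01.
by rewrite /= scale1r => /interior_subset.
Unshelve. all: by end_near. Qed.

(** A lift of an isometry of M taking the orbit of x to that of y is corrected by an element h of G
    so as to take x itself to y; the correction does not affect normalizing G. *)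
Lemma homogeneous_normalizer x y : homogeneous_quotient Q G ->
  exists2 g, Iso Q g /\ aff_app g x = y &
    forall c, G c -> exists2 c', G c' & aff_mul c g = aff_mul g c'.
Proof.
have [G1 GM GV] := Gs.
move=> /(_ (orbit G x) (orbit G y)) [||f fI fxy]; [by exists x|by exists y|].
have [g gI gf] := quotient_isometry_lift fI.
have [h Gh hgx] : exists2 h, G h & y = aff_app h (aff_app g x).
  by apply/orbit_eqP; rewrite -gf.
have gu := Iso_unit Qu gI.
(* As f is injective on orbits, [g^-1 c g] preserves every orbit, and comparing it with the identity
   by [near_same_orbit] puts it in G. *)
have norm_g c : G c -> exists2 c', G c' & aff_mul c g = aff_mul g c'.
  move=> Gc.
  have : exists2 c', G c' & aff_mul (aff_inv g) (aff_mul c g) = aff_mul c'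
    (aff_one R n).
    apply: (@near_same_orbit _ _ 0); near=> z.
    rewrite /aff_app mul1mx addr0 -/(aff_app _ z) !aff_appM.
    case: fI => -[_ fi _] _; apply: fi; rewrite ?inE; [by exists z|by eexists|].
    rewrite !gf aff_appK//; apply/orbit_eqP; exists c => //.
  case=> c' Gc' e; exists c' => //; apply: aff_ext => z.
  have := congr1 (fun k => aff_app g (aff_app k z)) e.
  by rewrite !aff_appM aff_appK// => ->;
    rewrite [aff_app (aff_one _ _) _]/aff_app mul1mx addr0.
exists (aff_mul h g).
  split; last by rewrite aff_appM.
  by move=> u v /=; rewrite -!mulmxA (GI Gh) gI.
move=> c Gc.
have [c' Gc' e] := norm_g (aff_mul (aff_inv h) (aff_mul c h)) (GM _ _ (GV _
  Gh) (GM _ _ Gc Gh)).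
exists c' => //; apply: aff_ext => z.
have := congr1 (fun k => aff_app h (aff_app k z)) e.
by rewrite !aff_appM aff_appK// Gu.
Unshelve. all: by end_near. Qed.

End Lift.

(** * Bilinear forms and skew maps *)

Lemma eq_oppr0 (R : numFieldType) (V : lmodType R) (x : V) : x = - x -> x = 0.
Proof.
move=> e; have : 2%:R *: x = 0 by rewrite scaler_nat mulr2n {1}e addNr.
by move/eqP; rewrite scaler_eq0 pnatr_eq0 => /eqP.
Qed.

Section Form.
Variables (R : realType) (n : nat) (Q : 'M[R]_n).
Implicit Types (a : R) (x y z : 'cV[R]_n) (A B : 'M[R]_n).

Lemma formDl x y z : form Q (x + y) z = form Q x z + form Q y z.
Proof. by rewrite /form linearD !mulmxDl mxE. Qed.

Lemma formDr x y z : form Q x (y + z) = form Q x y + form Q x z.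
Proof. by rewrite /form mulmxDr mxE. Qed.

Lemma formZl a x y : form Q (a *: x) y = a * form Q x y.
Proof. by rewrite /form linearZ -!scalemxAl mxE. Qed.

Lemma formZr a x y : form Q x (a *: y) = a * form Q x y.
Proof. by rewrite /form -scalemxAr mxE. Qed.

Lemma formNr x y : form Q x (- y) = - form Q x y.
Proof. by rewrite -scaleN1r formZr mulN1r. Qed.

Lemma form0l x : form Q 0 x = 0.
Proof. by rewrite -(scale0r 0) formZl mul0r. Qed.

Lemma form0r x : form Q x 0 = 0.
Proof. by rewrite -(scale0r 0) formZr mul0r. Qed.

Lemma form_suml (I : Type) (r : seq I) (P : pred I) (F : I -> 'cV[R]_n) y :
  form Q (\sum_(i <- r | P i) F i) y = \sum_(i <- r | P i) form Q (F i) y.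
Proof. by apply: (big_morph (form Q ^~ y)) => [u v|];
  rewrite ?formDl ?form0l. Qed.

Lemma form_sumr (I : Type) (r : seq I) (P : pred I) (F : I -> 'cV[R]_n) y :
  form Q y (\sum_(i <- r | P i) F i) = \sum_(i <- r | P i) form Q y (F i).
Proof. by apply: (big_morph (form Q y)) => [u v|]; rewrite ?formDr ?form0r. Qed.

Lemma form_alternating : (forall x, form Q x x = 0) -> Q^T = - Q.
Proof.
move=> alt; apply/matrixP => i j; rewrite !mxE.
have := alt (delta_mx i 0 + delta_mx j 0).
rewrite formDl !formDr !alt add0r addr0 !form_delta => /eqP.
by rewrite addrC addr_eq0 => /eqP.
Qed.

Hypothesis Qsym : Q^T = Q.

Lemma formC x y : form Q x y = form Q y x.
Proof.
rewrite /form -[in LHS](trmxK (x^T *m Q *m y)) mxE.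
by rewrite !trmx_mul trmxK Qsym mulmxA.
Qed.

Hypothesis Qu : Q \in unitmx.

Lemma form_nondegenerate x : (forall y, form Q y x = 0) -> x = 0.
Proof.
move=> x0; suff Qx0 : Q *m x = 0 by rewrite -(mulKmx Qu x) Qx0 mulmx0.
apply/matrixP => i j; rewrite ord1 [RHS]mxE.
by have := x0 (delta_mx i 0); rewrite formE trmx_delta -rowE mxE.
Qed.

Definition skew A := A^T *m Q = - (Q *m A).

Lemma skewP A x y : skew A -> form Q (A *m x) y = - form Q x (A *m y).
Proof.
by move=> sA; rewrite /form trmx_mul -[in LHS](mulmxA x^T) sA mulmxN mulNmx
  mxE !mulmxA.
Qed.

Lemma skew_ker A x :
  skew A -> (forall y, form Q (A *m y) x = 0) -> A *m x = 0.
Proof.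
move=> sA Ax; apply: form_nondegenerate => y.
by apply: oppr_inj; rewrite -skewP// Ax oppr0.
Qed.

Lemma skew_form_diag A x : skew A -> form Q (A *m x) x = 0.
Proof.
by move=> sA; apply: (@eq_oppr0 R R^o); rewrite {1}skewP// formC.
Qed.

End Form.

(** * Constancy of displacement pairings and its consequences for linear parts *)

Section Invariants.
Variables (R : realType) (n : nat) (Q : 'M[R]_n) (G : set (aff R n)).
Hypothesis Qsym : Q^T = Q.
Hypothesis Qu : Q \in unitmx.
Hypothesis hG : complete_homogeneous_flat Q G.
Implicit Types (c d g : aff R n) (x y z : 'cV[R]_n).

Definition disp c x := (c.1 - 1%:M) *m x + c.2.

Lemma dispE c x : disp c x = aff_app c x - x.
Proof. by rewrite /disp /aff_app mulmxBl mul1mx addrAC. Qed.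

Lemma disp_conj g c c' x : aff_mul c g = aff_mul g c' ->
  disp c (aff_app g x) = g.1 *m disp c' x.
Proof.
move=> e; rewrite !dispE -aff_appM e aff_appM.
by move: (aff_app c' x) => y;
  rewrite mulmxBr /aff_app opprD addrACA subrr addr0.
Qed.

(** Along the ray [t *: x] the pairing of the displacements of c and d is a quadratic polynomial in
    t. It takes countably many values, so its coefficients of degree 2 and 1, which are the two
    expressions, vanish. *)
Lemma disp_form_const c d : G c -> G d ->
  (forall x, form Q ((c.1 - 1%:M) *m x) ((d.1 - 1%:M) *m x) = 0) /\
  (forall x, form Q ((c.1 - 1%:M) *m x) d.2 + form Q c.2 ((d.1 - 1%:M) *m x) =
    0).
Proof.
move=> Gc Gd; have [GI Gs _ Gpd Gh] := hG.
pose V := (fun ab : aff R n * aff R n => form Q ab.1.2 ab.2.2) @` (G `*` G).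
have cV : countable V.
  have cG := countable_group Gpd.
  exact: sub_countable (card_image_le _ _) (countableX cG cG).
have VF x : V (form Q (disp c x) (disp d x)).
  have [g [gI <-] Ng] := homogeneous_normalizer Qu GI Gs Gpd 0 x Gh.
  have [[c' Gc' ce] [d' Gd' de]] := (Ng _ Gc, Ng _ Gd).
  exists (c', d') => //=.
  by rewrite (disp_conj _ ce) (disp_conj _ de) gI /disp !mulmx0 !add0r.
suff E x : form Q ((c.1 - 1%:M) *m x) ((d.1 - 1%:M) *m x) = 0 /\
    form Q ((c.1 - 1%:M) *m x) d.2 + form Q c.2 ((d.1 - 1%:M) *m x) = 0.
  by split=> x; have [] := E x.
set a := form Q _ _; set b := _ + _.
pose p := a%:P * 'X^2 + b%:P * 'X + (form Q c.2 d.2)%:P.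
have : (size p <= 1)%N.
  apply: countable_values_const cV _ => t;
    rewrite (_ : _.[t] = form Q (disp c (t *: x)) (disp d (t *: x)))//.
  rewrite !(hornerD, hornerM, hornerXn, hornerX,
    hornerC) /disp -!scalemxAr !formDl !formDr !formZl !formZr /a /b.
  by ring.
move/size1_polyC => pE; split.
  have := congr1 (fun q : {poly R} => q`_2) pE.
  by rewrite !coefD !coefCM !coefXn !coefX !coefC /= mulr0 mulr1 !addr0.
have := congr1 (fun q : {poly R} => q`_1) pE.
by rewrite !coefD !coefCM !coefXn !coefX !coefC /= mulr0 mulr1 add0r addr0.
Qed.

(** Moving z to x by a normalizing isometry turns the relation at x into the same relation at z for
    a conjugate pair. There are countably many pairs, so by [affine_cover] the relation of one of
    them is an identity. *)
Lemma disp_relation_const c d a b x : G c -> G d ->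
  a *: disp c x + b *: disp d x = 0 ->
  forall y, a *: disp c y + b *: disp d y = 0.
Proof.
move=> Gc Gd x0 y; have [GI Gs _ Gpd Gh] := hG.
(* The conjugating isometry g is recorded in D, so that the identity can be carried back to c and
   d. *)
pose D := [set cd : aff R n * aff R n | [/\ G cd.1, G cd.2 &
  exists g, [/\ Iso Q g, aff_mul c g = aff_mul g cd.1 & aff_mul d g = aff_mul
    g cd.2]]].
have cD : countable D.
  have cG := countable_group Gpd.
  by apply: sub_countable (countableX cG cG); apply: subset_card_le => cd [].
pose M (cd : aff R n * aff R n) := a *: (cd.1.1 - 1%:M) + b *: (cd.2.1 - 1%:M).
pose v (cd : aff R n * aff R n) := a *: cd.1.2 + b *: cd.2.2.
have ME cd z : M cd *m z + v cd = a *: disp cd.1 z + b *: disp cd.2 z.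
  by rewrite mulmxDl -!scalemxAl /disp !scalerDr addrACA.
have [|cd [_ _ [g [gI ce de]]] [M0 v0]] := @affine_cover R n _ D M v 0 cD.
  near=> z.
  have [g [gI gz] Ng] := homogeneous_normalizer Qu GI Gs Gpd z x Gh.
  have [[c' Gc' ce] [d' Gd' de]] := (Ng _ Gc, Ng _ Gd).
  exists (c', d'); first by split=> //; exists g.
  apply: (can_inj (mulKmx (Iso_unit Qu gI))).
  by rewrite ME mulmx0 mulmxDr -!scalemxAr -(disp_conj _ ce) -(disp_conj _ de)
    gz.
rewrite -(aff_appK y (Iso_unit Qu gI)) (disp_conj _ ce) (disp_conj _ de).
by rewrite !scalemxAr -mulmxDr -ME M0 v0 mul0mx addr0 mulmx0.
Unshelve. all: by end_near. Qed.

(** The matrix [A^T Q A] is symmetric, and alternating by [disp_form_const], so it is 0; the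
    isometry condition then reduces to [A^T Q + Q A = 0]. *)
Lemma linear_part_skew c : G c -> skew Q (c.1 - 1%:M).
Proof.
move=> Gc; have [GI _ _ _ _] := hG; set A := c.1 - 1%:M.
have [A0 _] := disp_form_const Gc Gc.
have /form_alternating : forall x, form (A^T *m Q *m A) x x = 0.
  by move=> x; rewrite -formM; exact: A0.
rewrite !trmx_mul trmxK Qsym mulmxA => /eq_oppr0 AQA.
have cE : c.1 = A + 1%:M by rewrite subrK.
move: A {A0} AQA cE => A AQA cE.
have := Iso_gram (GI _ Gc); rewrite cE [(A + _)^T]linearD /= trmx1.
rewrite !(mulmxDl, mulmxDr) AQA !mul1mx !mulmx1 add0r addrA.
by move=> /(canRL (addrK _)); rewrite subrr => /eqP;
  rewrite addrC addr_eq0 => /eqP.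
Qed.

(** The matrix [A^T Q B] is alternating. By skewness it equals [- Q A B] and its transpose equals
    [- Q B A]. *)
Lemma linear_part_anticommute c d : G c -> G d ->
  (c.1 - 1%:M) *m (d.1 - 1%:M) = - ((d.1 - 1%:M) *m (c.1 - 1%:M)).
Proof.
move=> Gc Gd; set A := c.1 - 1%:M; set B := d.1 - 1%:M.
have /form_alternating : forall x, form (A^T *m Q *m B) x x = 0.
  by move=> x; rewrite -formM; have [+ _] := disp_form_const Gc Gd; exact.
have [sA sB] := (linear_part_skew Gc, linear_part_skew Gd).
rewrite !trmx_mul trmxK Qsym mulmxA sA sB !mulNmx -!mulmxA opprK => /eqP.
rewrite eqr_oppLR -mulmxN => /eqP/(can_inj (mulKmx Qu)) ->.
by rewrite opprK.
Qed.

Lemma linear_part_sqr0 c : G c -> (c.1 - 1%:M) *m (c.1 - 1%:M) = 0.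
Proof.
by move=> Gc; apply: eq_oppr0; exact: linear_part_anticommute.
Qed.

(** This is the degree-one identity of [disp_form_const], read through skewness and
    non-degeneracy. *)
Lemma linear_part_translation c d : G c -> G d ->
  (c.1 - 1%:M) *m d.2 = - ((d.1 - 1%:M) *m c.2).
Proof.
move=> Gc Gd; apply/eqP; rewrite -subr_eq0 opprK; apply/eqP.
apply: (form_nondegenerate Qu) => y.
have [_ /(_ y)] := disp_form_const Gc Gd.
rewrite skewP; last exact: linear_part_skew.
rewrite [form Q c.2 _]formC// skewP; last exact: linear_part_skew.
by rewrite -opprD -formDr => /eqP; rewrite oppr_eq0 => /eqP.
Qed.

Lemma linear_part_translation0 c : G c -> (c.1 - 1%:M) *m c.2 = 0.
Proof.
by move=> Gc; apply: eq_oppr0; exact: linear_part_translation.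
Qed.

End Invariants.

(** * Images of linear maps, and dimension bounds from the signature *)

Section Image.
Variables (R : realType) (n : nat).

Definition image_mx (A : 'M[R]_n) : {vspace 'cV[R]_n} :=
  limg (linfun (mulmx A : 'cV[R]_n -> 'cV[R]_n)).

Lemma image_mxP (A : 'M[R]_n) x :
  reflect (exists y, x = A *m y) (x \in image_mx A).
Proof.
apply: (iffP memv_imgP) => [[y _ ->]|[y ->]]; exists y; rewrite ?memvf//.
  by rewrite lfunE.
by rewrite lfunE.
Qed.

End Image.

Section Signature.
Variables (R : realType) (n s : nat) (Q : 'M[R]_n).
Hypothesis sn : (s <= n)%N.
Hypothesis hQ : has_signature Q s.
Implicit Types (x y : 'cV[R]_n) (U : {vspace 'cV[R]_n}).

Lemma signature_sym : Q^T = Q.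
Proof.
have [P Pu e] := hQ.
have -> : Q = (invmx P)^T *m std_gram R n s *m invmx P.
  by rewrite -e !mulmxA -trmx_mul mulmxV// trmx1 mul1mx mulmxK.
by rewrite !trmx_mul trmxK /std_gram tr_diag_mx mulmxA.
Qed.

Lemma signature_unit : Q \in unitmx.
Proof.
have [P Pu e] := hQ.
suff : std_gram R n s \in unitmx by rewrite -e !unitmx_mul => /andP[/andP[]].
rewrite unitmxE det_diag unitfE; apply/prodf_neq0 => i _.
by rewrite !mxE; case: ifP => _; rewrite ?oppr_eq0 oner_eq0.
Qed.

(* U meets the positive definite span of the first n - s vectors of a
   Sylvester basis trivially. *)
Lemma isotropic_dim U : totally_isotropic Q U -> (\dim U <= s)%N.
Proof.
move=> iU; have [P Pu e] := hQ.
have hlt (i : 'I_s) : (n - s + i < n)%N by case: i => i /=; lia.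
(* The map f below reads off the last s Sylvester coordinates. The form is positive definite on its
   kernel, so f is injective on U. *)
pose h (i : 'I_s) := Ordinal (hlt i).
pose f : 'Hom('cV[R]_n, 'cV[R]_s) := linfun (mulmx (rowsub h (invmx P))).
rewrite -(limg_ker_dim f U) (_ : (U :&: lker f)%VS = 0%VS).
  by rewrite dimv0 add0n (leq_trans (dimvS (subvf _)))// dimvf dim_matrix mulr1.
apply/eqP; rewrite -subv0; apply/subvP => x.
rewrite memv_cap memv_ker lfunE /= memv0 => /andP[xU /eqP fx].
pose y := invmx P *m x.
have y0 (i : 'I_n) : (n - s <= i)%N -> y i 0 = 0.
  move=> ni; have ilt : (i - (n - s) < s)%N by have := ltn_ord i; lia.
  have := congr1 (fun z : 'cV[R]_s => z (Ordinal ilt) 0) fx.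
  rewrite mul_rowsub_mx [LHS]mxE [RHS]mxE -/y => <-; congr (y _ 0).
  by apply/val_inj => /=; lia.
suff : y = 0 by move=> y00; rewrite -(mulKVmx Pu x) -/y y00 mulmx0.
have : form (std_gram R n s) y y = 0.
  by rewrite -e -formM mulKVmx// iU.
have -> : form (std_gram R n s) y y = \sum_i (y i 0) ^+ 2.
  rewrite /form mul_mx_diag mxE; apply: eq_bigr => i _; move: (y0 i).
  move: y {y0} => y y0; rewrite !mxE; case: ltnP y0 => [_ _|_ ->//].
    by rewrite mulr1 expr2.
  by rewrite mulr0 expr0n.
move/eqP; rewrite psumr_eq0 => [/allP y00|i _]; last exact: sqr_ge0.
apply/matrixP => i j; rewrite ord1 [RHS]mxE.
by have /implyP/(_ isT) := y00 i (mem_index_enum i); rewrite sqrf_eq0 => /eqP.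
Qed.

(** Take x, y with <A x, y> nonzero. As <A y, y> = 0, the vector A x is no multiple of A y; and A y
    is nonzero because <x, A y> = - <A x, y>. *)
Lemma skew_image_dim (A : 'M[R]_n) :
  skew Q A -> A != 0 -> (2 <= \dim (image_mx A))%N.
Proof.
move=> sA A0; have Qs := signature_sym; have Qu := signature_unit.
have [x [y xy]] : exists x y, form Q (A *m x) y != 0.
  apply: contrapT => nxy; move/eqP: A0; apply.
  apply/matrixP => i j; rewrite [RHS]mxE.
  suff : A *m (delta_mx j 0 : 'cV[R]_n) = 0 by rewrite -colE =>
    /matrixP/(_ i 0); rewrite !mxE.
  apply: (form_nondegenerate Qu) => y; rewrite formC//.
  by apply/eqP/negP => /negP ?; apply: nxy; exists (delta_mx j 0), y.
have : free [:: A *m x; A *m y].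
  rewrite free_cons seq1_free; apply/andP; split.
    rewrite span_seq1; apply/negP => /vlineP [k e].
    by move: xy; rewrite e formZl skew_form_diag// mulr0 eqxx.
  apply: contraNneq xy => Ay.
  by rewrite skewP// Ay form0r oppr0.
rewrite /free /= => /eqP <-; apply: dimvS; apply/span_subvP => z.
by rewrite !inE => /orP[] /eqP ->; apply/image_mxP; eexists.
Qed.

End Signature.

(** * Linear parts in low index *)

Section LowIndex.
Variables (R : realType) (n s : nat) (Q : 'M[R]_n) (G : set (aff R n)).
Hypothesis sn : (s <= n)%N.
Hypothesis hQ : has_signature Q s.
Hypothesis hG : complete_homogeneous_flat Q G.
Implicit Types (c d : aff R n).

Let Qs : Q^T = Q := signature_sym hQ.
Let Qu : Q \in unitmx := signature_unit hQ.

Lemma linear_part_isotropic c :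
  G c -> totally_isotropic Q (image_mx (c.1 - 1%:M)).
Proof.
move=> Gc _ _ /image_mxP[x ->] /image_mxP[y ->].
rewrite skewP; last exact: linear_part_skew hG _ Gc.
by rewrite mulmxA (linear_part_sqr0 Qs Qu hG)// mul0mx form0r oppr0.
Qed.

Lemma index1_pure_translations : (s <= 1)%N -> pure_translations G.
Proof.
move=> s1 c Gc; apply/eqP; rewrite -subr_eq0; apply/negP => /negP A0.
have := skew_image_dim hQ (linear_part_skew Qs Qu hG Gc) A0.
have := isotropic_dim sn hQ (linear_part_isotropic Gc).
by lia.
Qed.

Hypothesis s2 : (s <= 2)%N.

Lemma linear_part_image_dim c :
  G c -> c.1 - 1%:M != 0 -> \dim (image_mx (c.1 - 1%:M)) = 2%N.
Proof.
move=> Gc A0; apply/eqP; rewrite eqn_leq.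
rewrite (leq_trans (isotropic_dim sn hQ (linear_part_isotropic Gc)) s2) /=.
exact: (skew_image_dim hQ (linear_part_skew Qs Qu hG Gc) A0).
Qed.

(* A nonzero product has rank 2, as it is skew, so both factors share its
   image; but each factor kills its own image. *)
Lemma linear_part_mul0 c d : G c -> G d -> (c.1 - 1%:M) *m (d.1 - 1%:M) = 0.
Proof.
move=> Gc Gd; apply/eqP; apply: contrapT => /negP T0.
have TE := linear_part_anticommute Qs Qu hG Gc Gd.
set A := c.1 - 1%:M in T0 TE *; set B := d.1 - 1%:M in T0 TE *.
have sA : skew Q A := linear_part_skew Qs Qu hG Gc.
have sB : skew Q B := linear_part_skew Qs Qu hG Gd.
(* A product of two skew maps is skew precisely because the factors anticommute. *)
have sT : skew Q (A *m B).
  by rewrite /skew trmx_mul -mulmxA sA mulmxN (mulmxA B^T) sB mulNmx opprK TE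
    mulmxN opprK mulmxA.
have A0 : A != 0 by apply: contraNneq T0 => ->; rewrite mul0mx.
have B0 : B != 0 by apply: contraNneq T0 => ->; rewrite mulmx0.
have dT := skew_image_dim hQ sT T0.
have eA : image_mx (A *m B) = image_mx A.
  apply/eqP; rewrite eqEdim linear_part_image_dim// dT andbT.
  by apply/subvP => _ /image_mxP[x ->]; apply/image_mxP; exists (B *m x);
    rewrite mulmxA.
have eB : image_mx (A *m B) = image_mx B.
  apply/eqP; rewrite eqEdim linear_part_image_dim// dT andbT.
  apply/subvP => _ /image_mxP[x ->]; apply/image_mxP; exists (- (A *m x)).
  by rewrite TE mulmxN mulNmx mulmxA.
case/negP: T0; apply/eqP/matrixP => i j; rewrite [RHS]mxE.
have : B *m (delta_mx j 0 : 'cV[R]_n) \in image_mx A.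
  by rewrite -eA eB; apply/image_mxP; eexists.
move=> /image_mxP[y e]; have := congr1 (mulmx A) e.
rewrite mulmxA [RHS]mulmxA (linear_part_sqr0 Qs Qu hG)// mul0mx -colE.
by move/matrixP/(_ i 0); rewrite mxE [RHS]mxE.
Qed.

(** All products of linear parts vanish, so the sum of the two images is totally isotropic. Its
    dimension is at most 2, which the image of A alone attains. *)
Lemma linear_part_image_sub c d : G c -> G d -> c.1 - 1%:M != 0 ->
  (image_mx (d.1 - 1%:M) <= image_mx (c.1 - 1%:M))%VS.
Proof.
move=> Gc Gd A0; set A := c.1 - 1%:M; set B := d.1 - 1%:M.
suff iAB : totally_isotropic Q (image_mx A + image_mx B)%VS.
  have := leq_trans (isotropic_dim sn hQ iAB) s2.
  rewrite -(linear_part_image_dim Gc A0) => le.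
  have /eqP -> : image_mx A == (image_mx A + image_mx B)%VS.
    by rewrite eqEdim addvSl.
  exact: addvSr.
move=> p q /memv_addP[_ /image_mxP[x ->] [_ /image_mxP[y ->] ->]].
move=> /memv_addP[_ /image_mxP[x' ->] [_ /image_mxP[y' ->] ->]].
rewrite formDl !formDr !(skewP _ _ (linear_part_skew Qs Qu hG _))// !mulmxA.
by rewrite !linear_part_mul0// !mul0mx !form0r !oppr0 !addr0.
Qed.

(** Up to sign, A v_d is B v_c. The vector v_c is orthogonal to the image of A, since A v_c = 0;
    that image contains the image of B, so the skew map B kills v_c. *)
Lemma linear_part_kills_translations c d :
  G c -> G d -> (c.1 - 1%:M) *m d.2 = 0.
Proof.
move=> Gc Gd; have [->|A0] := eqVneq (c.1 - 1%:M) 0; first by rewrite mul0mx.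
rewrite (linear_part_translation Qs Qu hG)//.
suff -> : (d.1 - 1%:M) *m c.2 = 0 by rewrite oppr0.
apply: (skew_ker Qu (linear_part_skew Qs Qu hG Gd)). move=> y.
have /image_mxP[z ->] : (d.1 - 1%:M) *m y \in image_mx (c.1 - 1%:M).
  by apply: (subvP (linear_part_image_sub Gc Gd A0)); apply/image_mxP; exists y.
rewrite (skewP _ _ (linear_part_skew Qs Qu hG Gc)).
by rewrite (linear_part_translation0 Qs Qu hG)// form0r oppr0.
Qed.

End LowIndex.

(** * Integral bases of discrete subgroups of R^n *)

Section Lattice.
Variables (R : realType) (n : nat) (L : set 'cV[R]_n).
Hypothesis L0 : L 0.
Hypothesis LB : forall x y, L x -> L y -> L (x - y).
Hypothesis Ldisc :
  forall m : R, finite_set [set x | L x /\ forall i, `|x i 0| <= m].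

Definition int_span r (b : r.-tuple 'cV[R]_n) : set 'cV[R]_n :=
  [set x | exists a : 'I_r -> int, x = \sum_i (a i)%:~R *: b`_i].

Lemma lattice_opp x : L x -> L (- x).
Proof. by move=> Lx; rewrite -sub0r; exact: LB. Qed.

Lemma lattice_add x y : L x -> L y -> L (x + y).
Proof. by move=> Lx Ly; rewrite -(opprK y); apply: LB => //;
  exact: lattice_opp. Qed.

Lemma lattice_intmul x (k : int) : L x -> L (k%:~R *: x).
Proof.
move=> Lx; rewrite scaler_int.
have Ln (m : nat) : L (x *+ m).
  by elim: m => [|m IH]; rewrite ?mulr0n// mulrS; exact: lattice_add.
by case: k => m; rewrite ?NegzE ?mulrNz; [|apply: lattice_opp]; exact: Ln.
Qed.

Lemma lattice_sum (I : Type) (r : seq I) (P : pred I) (F : I -> 'cV[R]_n) :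
  (forall i, L (F i)) -> L (\sum_(i <- r | P i) F i).
Proof. by move=> LF; elim/big_ind: _ => // *; exact: lattice_add. Qed.

Lemma int_span_lattice r (b : r.-tuple 'cV[R]_n) x :
  (forall i : 'I_r, L b`_i) -> int_span b x -> L x.
Proof. by move=> Lb [a ->]; apply: lattice_sum => i; exact: lattice_intmul. Qed.

Lemma seq_argmin (T : eqType) (f : T -> R) (s : seq T) x0 : x0 \in s ->
  exists2 x, x \in s & {in s, forall y, f x <= f y}.
Proof.
elim: s x0 => // a s IH x0 _; case: s IH => [|a' s] IH.
  by exists a; rewrite ?mem_head// => y; rewrite inE => /eqP ->.
have [x xs xmin] := IH a' (mem_head _ _).
have [ax|xa] := leP (f a) (f x).
  exists a; rewrite ?mem_head// => y; rewrite inE => /orP[/eqP->//|ys].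
  exact: le_trans ax (xmin _ ys).
exists x; first by rewrite inE xs orbT.
by move=> y; rewrite inE => /orP[/eqP->|/xmin//]; exact: ltW.
Qed.

(* Relative to a Z-basis of the part of L in the span of the tail of b, the
   missing vector is one with the least positive b_0-coordinate. *)
Lemma lattice_basis_in_span r (b : r.-tuple 'cV[R]_n) :
    free b -> (forall i : 'I_r, L b`_i) ->
  exists b' : r.-tuple 'cV[R]_n,
    [/\ free b', forall i : 'I_r, L b'`_i, <<b'>>%VS = <<b>>%VS
      & forall x, L x -> x \in <<b>>%VS -> int_span b' x].
Proof.
elim: r b => [|r IH] b fb Lb.
  exists b; split=> // x _; rewrite (tuple0 b) span_nil memv0 => /eqP ->.
  by exists (fun=> 0); rewrite big_ord0.
case/tupleP: b fb Lb => b0 bs; rewrite /= free_cons => /andP[b0bs fbs] Lb.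
have Lb0 : L b0 := Lb ord0.
have Lbs (i : 'I_r) : L bs`_i by have := Lb (lift ord0 i).
have [bs' [fbs' Lbs' sbs' bsZ]] := IH bs fbs Lbs.
(* The candidates for the missing vector: lattice vectors with b_0-coordinate in (0, 1] and the
   other coordinates in [0, 1]. The box is bounded, so S is finite, and it contains [b0]. *)
pose S := [set x | L x /\ exists t (y : 'I_r -> R),
  [/\ 0 < t, t <= 1, forall i,
    0 <= y i <= 1 & x = t *: b0 + \sum_i y i *: bs'`_i]].
have S_fin : finite_set S.
  pose m := `|b0| + \sum_(i < r) `|bs'`_i|.
  apply: sub_finite_set (Ldisc m) => x [Lx [t [y [t0 t1 y01 xE]]]];
    split=> // j.
  have xm : `|x| <= m.
    rewrite xE; apply: le_trans (ler_normD _ _) _; apply: lerD.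
      by rewrite normrZ gtr0_norm// ler_piMl.
    apply: le_trans (ler_norm_sum _ _ _) _; apply: ler_sum => i _.
    by rewrite normrZ; case/andP: (y01 i) => ? ?; rewrite ger0_norm// ler_piMl.
  apply: le_trans xm; rewrite [leRHS]/Num.norm/= mx_normrE.
  exact: (le_bigmax _ (fun ij : 'I_n * 'I_1 => `|x ij.1 ij.2|) (j, 0)).
have Sb0 : S b0.
  split=> //; exists 1, (fun=> 0); split=> // [i|]; first by rewrite lexx ler01.
  by rewrite scale1r big1 ?addr0// => i _; rewrite scale0r.
pose c := [tuple of b0 :: bs'].
have fc : free c by rewrite /= free_cons sbs' b0bs.
have coordc t y : coord c ord0 (t *: b0 + \sum_(i < r) y i *: bs'`_i) = t.
  have -> : t *: b0 + \sum_(i < r) y i *: bs'`_i =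
      \sum_(i < r.+1) (if unlift ord0 i is Some j then y j else t) *: c`_i.
    rewrite big_ord_recl unlift_none; congr (_ + _).
    by apply: eq_bigr => i _; rewrite liftK.
  by rewrite coord_sum_free// unlift_none.
have [s sS] := (finite_seqP S).1 S_fin.
have [xs xsS xsmin] : exists2 x, S x & forall y,
  S y -> coord c ord0 x <= coord c ord0 y.
  have [|x xs xmin] := @seq_argmin _ (coord c ord0) s b0; first by move: Sb0;
    rewrite sS.
  by exists x; rewrite sS//= => y; exact: xmin.
have [Lxs [t' [y' [t'0 t'1 y'01 xsE]]]] := xsS.
have ys_mem y : \sum_(i < r) y i *: bs'`_i \in <<bs>>%VS.
  rewrite -sbs'; apply: memv_suml => i _; apply: memvZ; apply: memv_span.
  by rewrite mem_nth// size_tuple.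
have xs_notin : xs \notin <<bs>>%VS.
  apply: contra b0bs => xsin.
  have -> : b0 = t'^-1 *: (xs - \sum_(i < r) y' i *: bs'`_i).
    by rewrite xsE addrK scalerA mulVf ?gt_eqF// scale1r.
  by apply: memvZ; apply: memvB.
have span_xs : <<xs :: bs'>>%VS = <<b0 :: bs>>%VS.
  apply/eqP; rewrite eqEdim !span_cons sbs'; apply/andP; split.
    rewrite subv_add addvSr andbT -memvE xsE.
    by apply: memv_add; [exact/memvZ/memv_line|exact: ys_mem].
  have := free_cons xs bs'; rewrite sbs' xs_notin fbs' /free span_cons sbs' =>
    /eqP ->.
  by rewrite -span_cons (leq_trans (dim_span _))//= !size_tuple.
exists [tuple of xs :: bs']; split.
- by rewrite /= free_cons sbs' xs_notin.
- by move=> i; case: (unliftP ord0 i) => [j|] ->; [exact: Lbs'|exact: Lxs].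
- exact: span_xs.
move=> x Lx xb.
have [t [y xE]] : exists t y, x = t *: b0 + \sum_(i < r) y i *: bs'`_i.
  move: xb; rewrite span_cons -sbs' => /memv_addP[u /vlineP[t ->] [v vbs ->]].
  by exists t, (fun i => coord bs' i v); rewrite -coord_span.
(* Division with remainder by the least coordinate t': subtracting k copies of [xs] leaves a
   b_0-coordinate [tz] in [0, t'). *)
pose k := Num.floor (t / t').
pose z := x - k%:~R *: xs.
have Lz : L z by apply: LB => //; exact: lattice_intmul.
pose tz := t - k%:~R * t'; pose yz i := y i - k%:~R * y' i.
have zE : z = tz *: b0 + \sum_(i < r) yz i *: bs'`_i.
  rewrite /z xE xsE scalerDr scalerA opprD addrACA -scalerBl; congr (_ + _).
  rewrite scaler_sumr -sumrB; apply: eq_bigr => i _.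
  by rewrite scalerA -scalerBl.
have /andP[tz0 tzt] : 0 <= tz < t'.
  have := floor_itv (t / t'); rewrite -/k ler_pdivlMr// ltr_pdivrMr//.
  by rewrite intrD mulrDl mul1r /tz subr_ge0 ltrBlDl => ->.
(* If [tz] were positive, reducing the other coordinates of z modulo 1 would give a member of S with
   a smaller b_0-coordinate than [xs]. *)
have tzE : tz = 0.
  apply/eqP; rewrite eq_le tz0 andbT leNgt; apply/negP => tz_gt0.
  pose w := z - \sum_(i < r) (Num.floor (yz i))%:~R *: bs'`_i.
  have wE : w = tz *: b0 + \sum_(i < r) (yz i - (Num.floor (yz i))%:~R) *:
    bs'`_i.
    by rewrite /w zE -addrA -sumrB; congr (_ + _); apply: eq_bigr => i _;
      exact/esym/scalerBl.
  have Sw : S w.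
    split; first by apply: LB => //; apply: lattice_sum => i;
      exact: lattice_intmul.
    exists tz, (fun i => yz i - (Num.floor (yz i))%:~R); split=> //.
      exact: le_trans (ltW tzt) t'1.
    move=> i; have /andP[f1 f2] := floor_itv (yz i).
    by rewrite subr_ge0 f1 /= lerBlDl; move: f2; rewrite intrD => /ltW.
  by have := xsmin _ Sw; rewrite xsE wE !coordc leNgt tzt.
have [|a aE] := bsZ z Lz; first by rewrite zE tzE scale0r add0r; exact: ys_mem.
exists (fun i => if unlift ord0 i is Some j then a j else k).
rewrite big_ord_recl unlift_none -[x](subrK (k%:~R *: xs)) -/z aE addrC;
  congr (_ + _).
by apply: eq_bigr => i _; rewrite liftK.
Qed.

(** An independent family in L of maximal length spans a subspace containing L, so
    [lattice_basis_in_span] accounts for all of L. *)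
Lemma lattice_basis : exists r (b : r.-tuple 'cV[R]_n),
  [/\ free b, forall i : 'I_r, L b`_i & L = int_span b].
Proof.
pose P r := `[< exists b : r.-tuple 'cV[R]_n, free b /\ forall i : 'I_r,
  L b`_i >].
have P0 : exists r, P r.
  exists 0; apply/asboolP; exists [tuple]; split; last by case.
  by rewrite /= nil_free.
have Pn r : P r -> (r <= n)%N.
  move=> /asboolP[b [fb _]]; have := dimvS (subvf <<b>>%VS).
  by rewrite (eqP fb) size_tuple dimvf dim_matrix mulr1.
have [r /asboolP[b [fb Lb]] rmax] := ex_maxnP P0 Pn.
have [b' [fb' Lb' sb' bZ]] := lattice_basis_in_span fb Lb.
exists r, b'; split=> //; apply/seteqP; split=> x; last exact: int_span_lattice.
move=> Lx; apply: bZ => //; apply: contrapT => /negP xb.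
suff /rmax : P r.+1 by rewrite ltnn.
apply/asboolP; exists [tuple of x :: b]; split;
  first by rewrite /= free_cons xb.
by move=> i; case: (unliftP ord0 i) => [j|] ->; [exact: Lb|exact: Lx].
Qed.

End Lattice.

(** * G as a lattice of translation parts *)

Section TranslationLattice.
Variables (R : realType) (n : nat) (Q : 'M[R]_n) (G : set (aff R n)).
Hypothesis Qu : Q \in unitmx.
Hypothesis hG : complete_homogeneous_flat Q G.
Hypothesis kills : forall c d, G c -> G d -> (c.1 - 1%:M) *m d.2 = 0.
Implicit Types (c d : aff R n).

Let Gu c : G c -> c.1 \in unitmx.
Proof. by have [GI _ _ _ _] := hG => /GI; exact: Iso_unit. Qed.

Let fixes c d : G c -> G d -> c.1 *m d.2 = d.2.
Proof.
by move=> Gc Gd; apply/eqP; rewrite -subr_eq0 -{2}[d.2]mul1mx -mulmxBl kills.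
Qed.

Lemma translationM c d : G c -> G d -> (aff_mul c d).2 = c.2 + d.2.
Proof. by move=> Gc Gd; rewrite /= fixes// addrC. Qed.

Lemma translationV c : G c -> (aff_inv c).2 = - c.2.
Proof. by move=> Gc; rewrite /= -{1}(fixes Gc Gc) mulKmx// Gu. Qed.

(** The element [c^-1 d] fixes 0, so it is the identity by freeness of the action. *)
Lemma translation_inj c d : G c -> G d -> c.2 = d.2 -> c = d.
Proof.
move=> Gc Gd e; have [_ [_ GM GV] Gf _ _] := hG.
have G1 : G (aff_mul (aff_inv c) d) by apply: GM => //; exact: GV.
have /Gf : aff_app (aff_mul (aff_inv c) d) 0 = 0.
  by rewrite /aff_app mulmx0 add0r (translationM (GV _ Gc) Gd) (translationV
    Gc) e addNr.
move=> /(_ G1) e1; apply: aff_ext => x.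
rewrite -[in RHS](aff_appK (aff_app d x) (Gu Gc)) -(aff_appM (aff_inv c)) e1.
by rewrite [aff_app (aff_one _ _) _]/aff_app mul1mx addr0.
Qed.

(** Linear parts fix translation parts, so [g |-> g.2] is a homomorphism; its image is discrete by
    [finite_translations]. *)
Lemma translation_basis : exists r (b : r.-tuple 'cV[R]_n),
  [/\ free b, forall i : 'I_r, exists2 c, G c & c.2 = b`_i,
      forall c, G c -> int_span b c.2
    & forall x, int_span b x -> exists2 c, G c & c.2 = x].
Proof.
have [_ [G1 GM GV] _ Gpd _] := hG.
have [|x y [c Gc <-] [d Gd <-]|m|r [b [fb Lb LE]]] :=
  @lattice_basis R n (snd @` G).
- by exists (aff_one R n).
- exists (aff_mul (aff_inv d) c); first by apply: GM => //; exact: GV.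
  by rewrite (translationM (GV _ Gd) Gc) (translationV Gd) addrC.
- have := finite_image snd (finite_translations Gpd m); apply: sub_finite_set.
  by move=> _ [[c Gc <-] cm]; exists c.
exists r, b; split=> // [c Gc|x].
- by rewrite -LE; exists c.
- by rewrite -LE => -[c]; exists c.
Qed.

Lemma free_abelian_on_basis r (b : r.-tuple 'cV[R]_n) : free b ->
    (forall c, G c -> int_span b c.2) ->
    (forall x, int_span b x -> exists2 c, G c & c.2 = x) ->
  free_abelian_of_rank G r.
Proof.
move=> fb Gb bG.
have /choice [phi phiP] : forall a : 'I_r -> int, exists c,
  G c /\ c.2 = \sum_i (a i)%:~R *: b`_i.
  by move=> a; have [|c Gc ce] := bG (\sum_i (a i)%:~R *: b`_i);
    [exists a|exists c].
have [_ [_ GM _] _ _ _] := hG.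
exists phi => Z; split; last first.
  move=> a a' _ _; have [[Ga ea] [Ga' ea']] := (phiP a, phiP a').
  have [G3 e3] := phiP (fun i => a i + a' i).
  apply: translation_inj => //; first exact: GM.
  rewrite translationM// e3 ea ea' -big_split; apply: eq_bigr => i _ /=.
  by rewrite intrD scalerDl.
split.
- by move=> a _; have [] := phiP a.
- move=> a a' _ _ e; apply/funext => i.
  have [[_ ea] [_ ea']] := (phiP a, phiP a').
  have : \sum_i ((a i)%:~R - (a' i)%:~R) *: b`_i = 0.
    under eq_bigr do rewrite scalerBl.
    by rewrite sumrB -ea -ea' e subrr.
  move=> /(freeP fb)/(_ i)/eqP; rewrite subr_eq0 eqr_int => /eqP; exact.
- move=> c Gc; have [a ca] := Gb c Gc; exists a.
    exact: finite_finset.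
  have [Ga ea] := phiP a.
  by apply: translation_inj => //; rewrite ea ca.
Qed.

(** Over the rationals, an identity matrix of rank p factors through dimension q. *)
Lemma int_mx_right_inverse_leq p q (M : 'M[int]_(p, q)) (N : 'M[int]_(q, p)) :
  M *m N = 1%:M -> (p <= q)%N.
Proof.
move=> e; have := congr1 (map_mx (intr : int -> rat)) e.
rewrite map_mxM map_mx1 => e'.
by rewrite -(mxrank1 rat p) -e' (leq_trans (mxrankM_maxl _ _))// rank_leq_col.
Qed.

(** This identifies the rank of an arbitrary isomorphism with Z^k as the length of the lattice
    basis: the two bases express each other by mutually inverse integer matrices. *)
Lemma free_abelian_rank_unique r (b : r.-tuple 'cV[R]_n) k : free b ->
    (forall c, G c -> int_span b c.2) ->
    (forall x, int_span b x -> exists2 c, G c & c.2 = x) ->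
  free_abelian_of_rank G k -> k = r.
Proof.
move=> fb Gb bG [phi [[phiG phi_inj phi_surj] phiD]].
have fin (a : 'I_k -> int) : finite_set [set i | a i <> 0].
  exact: finite_finset.
have Gphi a : G (phi a) by apply: phiG; exact: fin.
pose v (u : 'rV[int]_k) := (phi (u 0)).2.
have v_add : zmod_morphism v.
  move=> u w; apply/eqP; rewrite eq_sym subr_eq; apply/eqP.
  rewrite -translationM// /v -phiD; [|exact: fin..].
  by congr (phi _).2; apply/funext => i; rewrite !mxE subrK.
pose V : {additive 'rV[int]_k -> 'cV[R]_n} :=
  HB.pack v (GRing.isZmodMorphism.Build _ _ v v_add).
have vE u : v u = \sum_i (u 0 i)%:~R *: v (delta_mx 0 i).
  transitivity (V (\sum_i u 0 i *: delta_mx 0 i));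
    first by rewrite -row_sum_delta.
  rewrite raddf_sum; apply: eq_bigr => i _.
  by rewrite scaler_int -[u 0 i in LHS]intz scaler_int raddfMz.
have v_inj : injective v.
  move=> u w /translation_inj => /(_ (Gphi _) (Gphi _)) e; apply/rowP => i.
  by rewrite (phi_inj _ _ _ _ e)// inE; exact: fin.
pose B (x : 'rV[int]_r) := \sum_i (x 0 i)%:~R *: b`_i.
have B_inj : injective B.
  move=> u w e; apply/rowP => i.
  have : \sum_j ((u 0 j)%:~R - (w 0 j)%:~R) *: b`_j = 0.
    under eq_bigr do rewrite scalerBl.
    by rewrite sumrB -/(B u) e subrr.
  by move=> /(freeP fb)/(_ i)/eqP; rewrite subr_eq0 eqr_int => /eqP.
(* Here [m] writes the images of the standard basis of Z^k in terms of b, and [l] below writes b in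
   terms of those images. *)
have /choice [m mP] : forall i, exists u, v (delta_mx 0 i) = B u.
  move=> i; have [a e] := Gb _ (Gphi ((delta_mx 0 i : 'rV[int]_k) 0)).
  by exists (\row_j a j); rewrite /v e; apply: eq_bigr => j _; rewrite mxE.
have /choice [l lP] : forall i : 'I_r, exists u, b`_i = v u.
  move=> i; have [|c Gc <-] := bG b`_i.
    exists (fun j => (j == i)%:R);
      rewrite (bigD1 i)//= eqxx scale1r big1 ?addr0//.
    by move=> j /negPf ->; rewrite scale0r.
  have [a _ <-] := phi_surj _ Gc; exists (\row_j a j); congr (phi _).2.
  by apply/funext => j; rewrite mxE.
pose M := \matrix_i m i; pose N := \matrix_i l i.
have BM u : v u = B (u *m M).
  rewrite vE; under eq_bigr do rewrite mP /B scaler_sumr.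
  rewrite exchange_big; apply: eq_bigr => j _ /=.
  rewrite mxE rmorph_sum/= scaler_suml; apply: eq_bigr => i _.
  by rewrite scalerA !mxE intrM.
have vN u : B u = v (u *m N).
  rewrite /B; under eq_bigr do rewrite lP vE scaler_sumr.
  rewrite exchange_big vE; apply: eq_bigr => j _ /=.
  rewrite mxE rmorph_sum/= scaler_suml; apply: eq_bigr => i _.
  by rewrite scalerA !mxE intrM.
apply/eqP; rewrite eqn_leq; apply/andP; split.
  apply: (@int_mx_right_inverse_leq _ _ M N); apply/row_matrixP => i.
  by apply: v_inj; rewrite row_mul -vN -(mul1mx M) row_mul -BM.
apply: (@int_mx_right_inverse_leq _ _ N M); apply/row_matrixP => i.
by apply: B_inj; rewrite row_mul -BM -(mul1mx N) row_mul -vN.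
Qed.

(** The elements of G whose translation part lies in the span of the r given ones form a subgroup
    containing the generators, hence all of G. So r vectors span a space containing the r
    independent vectors of b. *)
Lemma generates_free r (b : r.-tuple 'cV[R]_n) (g : 'I_r -> aff R n) : free b ->
    (forall i : 'I_r, exists2 c, G c & c.2 = b`_i) -> generates g G ->
  free [seq (g i).2 | i : 'I_r].
Proof.
move=> fb bG gG; have [_ [G1 GM GV] _ _ _] := hG.
set W := [seq _ | _ : _]; have sW : size W = r by rewrite size_map
  size_enum_ord.
have sub : G `<=` [set c | G c /\ c.2 \in <<W>>%VS].
  rewrite -{1}gG; apply: smallest_sub.
    split=> [|c d [Gc cW] [Gd dW]|c [Gc cW]].
    - by split; rewrite ?mem0v.
    - by split; [exact: GM|rewrite translationM// memvD].
    - by split; [exact: GV|rewrite translationV// memvN].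
  move=> _ [i _ <-]; split.
    by rewrite -gG; apply: sub_gen_smallest; exists i.
  by apply: memv_span; apply: map_f; rewrite mem_enum.
rewrite /free eqn_leq dim_span sW -[X in (X <= _)%N](size_tuple b) -(eqP fb).
apply: dimvS; apply/span_subvP => y /(nthP 0)[i]; rewrite size_tuple => ir <-.
by have [c Gc ce] := bG (Ordinal ir); have [_] := sub c Gc; rewrite ce.
Qed.

End TranslationLattice.

(** * Matrices of columns, and existence of Witt bases *)

Section Columns.
Variables (R : realType) (n k : nat).
Implicit Types (e : k.-tuple 'cV[R]_n) (A : 'M[R]_n).

Definition cols_mx e : 'M[R]_(n, k) := \matrix_(l, j) tnth e j l 0.

Lemma col_cols_mx e j : col j (cols_mx e) = tnth e j.
Proof. by apply/matrixP => l i; rewrite ord1 !mxE. Qed.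

Lemma mul_cols_mx e (x : 'cV[R]_k) :
  cols_mx e *m x = \sum_j x j 0 *: tnth e j.
Proof.
apply/matrixP => l i; rewrite ord1 summxE mxE.
by apply: eq_bigr => j _; rewrite !mxE mulrC.
Qed.

Lemma cols_mx_free e : free e -> row_free (cols_mx e)^T.
Proof.
move=> fe; rewrite -kermx_eq0; set K := kermx _.
have KC : K *m (cols_mx e)^T = 0 by exact: mulmx_ker.
apply/eqP/matrixP => i j; rewrite [RHS]mxE.
apply: (freeP fe (fun j => K i j)); apply/matrixP => l z; rewrite ord1 [RHS]mxE.
transitivity ((K *m (cols_mx e)^T) i l); last by rewrite KC mxE.
rewrite summxE [RHS]mxE; apply: eq_bigr => q _.
by rewrite !mxE (tnth_nth 0).
Qed.

Lemma mx_eq_cols p (A B : 'M[R]_(n, p)) :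
  (forall j, col j A = col j B) -> A = B.
Proof. by move=> e; apply/matrixP => i j; have /matrixP/(_ i 0) := e j;
  rewrite !mxE. Qed.

End Columns.

Section WittExistence.
Variables (R : realType) (n k m : nat) (Q : 'M[R]_n) (U : {vspace 'cV[R]_n}).
Hypothesis Qs : Q^T = Q.
Hypothesis Qu : Q \in unitmx.
Hypothesis nE : n = (k + (m + k))%N.
Hypothesis iU : totally_isotropic Q U.
Hypothesis dU : \dim U = k.

Lemma form_span0 (X Y : seq 'cV[R]_n) :
    {in X & Y, forall x y, form Q x y = 0} ->
  {in <<X>>%VS & <<Y>>%VS, forall x y, form Q x y = 0}.
Proof.
move=> XY x y xX yY.
rewrite (coord_span (X := in_tuple X) xX) (coord_span (X := in_tuple Y) yY).
rewrite form_suml big1// => i _; rewrite form_sumr big1// => j _.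
by rewrite formZl formZr XY ?mulr0// mem_nth.
Qed.

Lemma gram_entry p q (A : 'M[R]_(n, p)) (B : 'M[R]_(n, q)) i j :
  (A^T *m Q *m B) i j = form Q (col i A) (col j B).
Proof. by rewrite /form tr_col [col j B]colE mulmxA -!row_mul -colE [RHS]mxE
  [RHS]mxE. Qed.

Lemma exists_witt_basis : exists u w us, witt_basis Q U (k := k) (m :=
  m) u w us.
Proof.
have [u bu] : exists u : k.-tuple 'cV[R]_n, basis_of U u.
  by move: (vbasis U) (vbasisP U); rewrite dU => u; exists u.
have fu := basis_free bu; have su := span_basis bu.
have uU i : tnth u i \in U by rewrite -su; apply: memv_span; exact: mem_tnth.
pose Cu := cols_mx u; have colu j : col j Cu = tnth u j := col_cols_mx u j.
have uu : Cu^T *m Q *m Cu = 0.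
  by apply/matrixP => i j; rewrite gram_entry !colu iU// mxE.
(* The columns of Z are dual to u, but need not be isotropic. *)
have [Z CZ] : exists Z, Cu^T *m Q *m Z = 1%:M.
  by apply/row_freeP; rewrite /row_free mxrankMfree ?row_free_unit//;
    exact: cols_mx_free.
have [S SE] : exists S, S = Z^T *m Q *m Z by eexists.
have ST : S^T = S by rewrite SE !trmx_mul trmxK Qs mulmxA.
(* Subtracting half the Gram matrix of Z along U makes the dual family isotropic; its pairing with u
   is unchanged because U is isotropic. *)
pose Cs := Z - 2^-1 *: (Cu *m S).
have us1 : Cu^T *m Q *m Cs = 1%:M.
  by rewrite mulmxBr CZ -scalemxAr mulmxA uu mul0mx scaler0 subr0.
have ZC : Z^T *m Q *m Cu = 1%:M.
  by apply: trmx_inj; rewrite !trmx_mul trmxK Qs trmx1 mulmxA.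
have ss0 : Cs^T *m Q *m Cs = 0.
  have -> : Cs^T = Z^T - 2^-1 *: (S *m Cu^T).
    by rewrite /Cs linearB linearZ /= trmx_mul ST.
  rewrite !mulmxBl -!scalemxAl -!(mulmxA S) us1 mulmx1.
  rewrite /Cs mulmxBr -scalemxAr mulmxA ZC mul1mx -SE.
  rewrite -addrA -opprD -scalerDl.
  by rewrite (_ : 2^-1 + 2^-1 = 1 :> R) ?scale1r ?subrr//; field.
pose us := [tuple col j Cs | j < k].
have cols j : tnth us j = col j Cs by rewrite tnth_mktuple.
have u_us i j : form Q (tnth u i) (tnth us j) = (i == j)%:R.
  by rewrite cols -colu -gram_entry us1 mxE.
have us_us i j : form Q (tnth us i) (tnth us j) = 0.
  by rewrite !cols -gram_entry ss0 mxE.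
have u_u i j : form Q (tnth u i) (tnth u j) = 0 by rewrite iU.
(* W is the orthogonal of u and [us] together, as a kernel. A right inverse of K makes f surjective,
   whence dim W = n - 2k = m. *)
pose K := col_mx (Cu^T *m Q) (Cs^T *m Q).
pose f : 'Hom('cV[R]_n, 'cV[R]_(k + k)) := linfun (mulmx K).
pose W := lker f.
have WP x : reflect (forall i,
  form Q (tnth u i) x = 0 /\ form Q (tnth us i) x = 0) (x \in W).
  have xE : x = col 0 x by apply/matrixP => i j; rewrite ord1 mxE.
  rewrite memv_ker lfunE /= mul_col_mx; apply: (iffP eqP) => [|x0].
    rewrite -col_mx0 => /eq_col_mx[e1 e2] i.
    by rewrite -colu cols xE -!gram_entry e1 e2 !mxE.
  rewrite -col_mx0; congr col_mx; apply/matrixP => i j;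
    rewrite ord1 [RHS]mxE gram_entry -xE.
    by rewrite colu; have [] := x0 i.
  by rewrite -cols; have [] := x0 i.
have dW : \dim W = m.
  have K1 : K *m row_mx Cs Cu = 1%:M.
    have sc : Cs^T *m Q *m Cu = 1%:M.
      by apply: trmx_inj; rewrite !trmx_mul trmxK Qs trmx1 mulmxA.
    by rewrite mul_col_row us1 uu ss0 sc scalar_mx_block.
  have fT : (f @: fullv)%VS = fullv.
    apply/eqP; rewrite eqEsubv subvf; apply/subvP => y _; apply/memv_imgP.
    by exists (row_mx Cs Cu *m y); rewrite ?memvf// lfunE /= mulmxA K1 mul1mx.
  have := limg_ker_dim f fullv; rewrite capfv fT !dimvf !dim_matrix !mulr1 -/W.
  by move: nE; lia.
have [w bw] : exists w : m.-tuple 'cV[R]_n, basis_of W w.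
  by move: (vbasis W) (vbasisP W); rewrite dW => w; exists w.
have sw := span_basis bw.
(* By duality, [pu] and [ps] are the components of x along u and along [us]; the remainder is
   orthogonal to both families. *)
pose pu x := \sum_(i < k) form Q x (tnth us i) *: tnth u i.
pose ps x := \sum_(i < k) form Q x (tnth u i) *: tnth us i.
have pW x : x - pu x - ps x \in W.
  apply/WP => i; rewrite !(formDr, formNr) !form_sumr; split.
    rewrite big1 ?oppr0 ?addr0 => [|j _]; last by rewrite formZr u_u mulr0.
    rewrite (bigD1 i)//= big1 ?addr0 => [|j ji];
      last by rewrite formZr u_us eq_sym (negPf ji) mulr0.
    by rewrite formZr u_us eqxx mulr1 formC// subrr.
  rewrite [X in _ - X]big1 ?subr0 => [|j _]; last by rewrite formZr us_us mulr0.
  rewrite (bigD1 i)//= big1 ?addr0 => [|j ji].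
    by rewrite formZr [X in _ * X]formC// u_us eqxx mulr1 formC// subrr.
  by rewrite formZr [X in _ * X]formC// u_us (negPf ji) mulr0.
have dec x : x = pu x + (x - pu x - ps x) + ps x.
  by rewrite -addrA subrK addrC subrK.
have puU x : pu x \in U by apply: memv_suml => i _; exact: memvZ.
have ps_span x : ps x \in <<us>>%VS.
  by apply: memv_suml => i _; apply/memvZ/memv_span; exact: mem_tnth.
have WU x y : x \in W -> y \in U -> form Q x y = 0.
  move=> /WP xW; rewrite -su => yU;
    rewrite (coord_span yU) form_sumr big1// => i _.
  by rewrite formZr -tnth_nth formC//; have [-> _] := xW i; rewrite mulr0.
have sW x y : x \in <<us>>%VS -> y \in W -> form Q x y = 0.
  move=> xs /WP yW; rewrite (coord_span xs) form_suml big1// => i _.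
  by rewrite formZl -tnth_nth; have [_ ->] := yW i; rewrite mulr0.
have in_us x : x \in us -> exists i, x = tnth us i by case/tnthP => i ->;
  exists i.
have ss x y : x \in <<us>>%VS -> y \in <<us>>%VS -> form Q x y = 0.
  move=> xs ys; apply: form_span0 xs ys => a b /in_us[i ->] /in_us[j ->].
  exact: us_us.
exists u, w, us; split=> //; rewrite ?sw //.
- rewrite basisEdim !size_cat !size_tuple dimvf dim_matrix mulr1.
  apply/andP; split; last by move: nE; lia.
  apply/subvP => x _; rewrite !span_cat su sw (dec x) -addrA.
  by rewrite memv_add// memv_add.
- move=> x xW Wx; apply: (form_nondegenerate Qu) => y.
  rewrite (dec y); have := pW y; move: (y - pu y - ps y) => q qW.
  rewrite !formDl [form Q (pu y) x]formC// WU// (sW _ _ (ps_span y) xW).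
  by rewrite addr0 add0r formC//; exact: Wx.
- move=> x; split=> [xU|/memv_addP[p pU [q qW ->]] y yU].
    have ps0 : ps x = 0 by rewrite /ps big1// => i _; rewrite xU// scale0r.
    have := pW x; rewrite ps0 subr0 => xW.
    by rewrite -[x](subrK (pu x)) addrC memv_add.
  by rewrite formDl iU// WU// addr0.
- rewrite directvE /=; apply/eqP; rewrite dimv_disjoint_sum//.
  apply/eqP; rewrite -subv0; apply/subvP => x;
    rewrite memv_cap memv0 -{1}su => /andP[xU /WP xW].
  rewrite (coord_span xU) big1// => i _.
  have [_] := xW i; rewrite {1}(coord_span xU) form_sumr (bigD1 i)//= big1 =>
    [|j ji].
    by rewrite addr0 formZr -tnth_nth formC// u_us eqxx mulr1 => ->;
      rewrite scale0r.
  by rewrite formZr -tnth_nth formC// u_us (negPf ji) mulr0.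
Qed.

End WittExistence.

(** * The normal form in a Witt basis *)

Lemma col_mulmx (R : pzSemiRingType) (m n p : nat) (A : 'M[R]_(m, n))
  (B : 'M[R]_(n, p)) j : col j (A *m B) = A *m col j B.
Proof. by apply/matrixP => i l; rewrite !mxE; apply: eq_bigr => q _;
  rewrite mxE. Qed.

Section NormalForm.
Variables (R : realType) (k m : nat).
Local Notation n := (k + (m + k))%N.

Lemma basis_mx_cat (u : k.-tuple 'cV[R]_n) (w : m.-tuple 'cV[R]_n)
    (us : k.-tuple 'cV[R]_n) :
  basis_mx [tuple of u ++ w ++ us] =
    row_mx (cols_mx u) (row_mx (cols_mx w) (cols_mx us)).
Proof.
apply/matrixP => i j; rewrite !mxE (tnth_nth 0) /= nth_cat size_tuple.
case: splitP => [j' ->|j' ->]; rewrite !mxE ?(tnth_nth 0)//.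
rewrite addKn nth_cat size_tuple.
by case: splitP => [l ->|l ->]; rewrite !mxE (tnth_nth 0)// addKn.
Qed.

Lemma basis_mx_unit (e : n.-tuple 'cV[R]_n) : free e -> basis_mx e \in unitmx.
Proof. by move=> /cols_mx_free; rewrite row_free_unit unitmx_tr. Qed.

End NormalForm.

Lemma ord2P (P : 'I_2 -> Prop) : P 0 -> P 1 -> forall i, P i.
Proof.
move=> P0 P1 i; case: (unliftP ord0 i) => [j|] -> //.
by rewrite ord1 (_ : lift _ _ = 1)//; apply/val_inj.
Qed.

Lemma sum_ord2 (V : nmodType) (F : 'I_2 -> V) : \sum_i F i = F 0 + F 1.
Proof.
by rewrite big_ord_recl big_ord1; congr (_ + F _); apply/val_inj.
Qed.

Section WittNormalForm.
Variables (R : realType) (Q : 'M[R]_(2 + (1 + 2))).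
Variable U : {vspace 'cV[R]_(2 + (1 + 2))}.
Variables (u : 2.-tuple 'cV[R]_(2 + (1 + 2))).
Variables (w : 1.-tuple 'cV[R]_(2 + (1 + 2))).
Variables (us : 2.-tuple 'cV[R]_(2 + (1 + 2))).
Hypothesis Qs : Q^T = Q.
Hypothesis Qu : Q \in unitmx.
Hypothesis wb : witt_basis Q U u w us.

Lemma witt_coord y : y \in U ->
  y = form Q y (tnth us 0) *: tnth u 0 + form Q y (tnth us 1) *: tnth u 1.
Proof.
rewrite -(span_basis (witt_basis_U wb)) => yU.
have coordE j : form Q y (tnth us j) = coord u j y.
  rewrite {1}(coord_span yU) form_suml (bigD1 j)//= -tnth_nth formZl.
  rewrite (witt_dual wb) eqxx mulr1 big1 ?addr0// => i ij.
  by rewrite -tnth_nth formZl (witt_dual wb) (negPf ij) mulr0.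
by rewrite {1}(coord_span yU) sum_ord2 !coordE !(tnth_nth 0).
Qed.

Variable c : aff R (2 + (1 + 2)).
Hypothesis cskew : skew Q (c.1 - 1%:M).
Hypothesis cU : (image_mx (c.1 - 1%:M) <= U)%VS.
Hypothesis corth : in_orthogonal Q U c.2.

Let A := c.1 - 1%:M.
(** This is the number c of the normal form: the coefficient of [u_0] in [A us_1], read off by
    pairing with [us_0] (indices start at 0). *)
Let a := form Q (A *m tnth us 1) (tnth us 0).

Let AU y : A *m y \in U.
Proof. by apply: (subvP cU); apply/image_mxP; exists y. Qed.

Let A_orth x : in_orthogonal Q U x -> A *m x = 0.
Proof. by move=> xU; apply: (skew_ker Qu cskew) => y; rewrite formC//;
  exact/xU/AU. Qed.

Lemma witt_image0 : A *m tnth us 0 = - a *: tnth u 1.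
Proof.
rewrite [LHS]witt_coord// skew_form_diag// scale0r add0r.
by rewrite (skewP _ _ cskew) formC.
Qed.

Lemma witt_image1 : A *m tnth us 1 = a *: tnth u 0.
Proof. by rewrite [LHS]witt_coord// skew_form_diag// scale0r addr0. Qed.

Lemma witt_kernel x : x \in (U + <<w>>)%VS -> A *m x = 0.
Proof. by move=> /(witt_orthogonal wb); exact: A_orth. Qed.

(** A kills the orthogonal of U, spanned by u and w, and skewness determines it on [us] up to the
    scalar a. The translation part is orthogonal to U, so it has no [us]-component; its expansion is
    kept for [witt_slope]. *)
Lemma witt_normal_form : exists x t,
  aff_in_basis (basis_mx [tuple of u ++ w ++ us]) c = normal_form a x t /\
  c.2 = x 0 0 *: tnth u 0 + x 1 0 *: tnth u 1 + t *: tnth w 0.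
Proof.
have /memv_addP[p pU [q qw cE]] := (witt_orthogonal wb c.2).1 corth.
pose x : 'cV[R]_2 := \col_i form Q p (tnth us i).
pose t := coord w 0 q.
have c2E : c.2 = x 0 0 *: tnth u 0 + x 1 0 *: tnth u 1 + t *: tnth w 0.
  rewrite cE !mxE -witt_coord//; congr (_ + _).
  by rewrite {1}(coord_span qw) big_ord1 (tnth_nth 0).
exists x, t; split=> //.
have fe : free [tuple of u ++ w ++ us] by apply: basis_free (witt_basis_full
  wb).
have Pu := basis_mx_unit fe.
have cA p' (M : 'M[R]_(_, p')) : c.1 *m M = A *m M + M.
  by rewrite /A mulmxBl mul1mx subrK.
have Au : A *m cols_mx u = 0.
  apply: mx_eq_cols => j; rewrite col_mulmx col_cols_mx witt_kernel ?col0//.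
  apply: (subvP (addvSl _ _)); rewrite -(span_basis (witt_basis_U wb)).
  by apply: memv_span; exact: mem_tnth.
have Aw : A *m cols_mx w = 0.
  apply: mx_eq_cols => j; rewrite col_mulmx col_cols_mx witt_kernel ?col0//.
  by apply: (subvP (addvSr _ _)); apply: memv_span; exact: mem_tnth.
have As : A *m cols_mx us = cols_mx u *m skew2 a.
  apply: mx_eq_cols => j; rewrite !col_mulmx col_cols_mx mul_cols_mx sum_ord2.
  move: j; apply: ord2P; rewrite !mxE /=.
    by rewrite witt_image0 scale0r add0r.
  by rewrite witt_image1 scale0r addr0.
rewrite /aff_in_basis /normal_form; congr (_, _).
  apply: (can_inj (mulKmx Pu)); rewrite -mulmxA mulKVmx//.
  rewrite basis_mx_cat mul_mx_row mul_mx_row mul_row_block -scalar_mx_block.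
  rewrite !mulmx1 mulmx0 addr0 mul_mx_row mulmx0 add_row_mx add0r.
  by rewrite !cA Au Aw As !add0r.
apply: (can_inj (mulKmx Pu)); rewrite mulKVmx// basis_mx_cat !mul_row_col.
rewrite mulmx0 addr0 mul_mx_scalar mul_cols_mx sum_ord2 c2E; congr (_ + _ *: _).
by rewrite -(col_cols_mx w 0); apply/matrixP => i j; rewrite ord1 !mxE.
Qed.

Lemma witt_coef_eq0 : a = 0 -> c.1 = 1%:M.
Proof.
move=> a0; have [x [t [/(congr1 fst) /= e _]]] := witt_normal_form.
have Pu : basis_mx [tuple of u ++ w ++ us] \in unitmx.
  by apply: basis_mx_unit; apply: basis_free (witt_basis_full wb).
have nf1 : invmx (basis_mx [tuple of u ++ w ++ us]) *m c.1 *m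
    basis_mx [tuple of u ++ w ++ us] = 1%:M.
  rewrite e a0 (_ : skew2 0 = 0) ?row_mx0 -?scalar_mx_block//.
  by apply/matrixP => i j; rewrite !mxE oppr0 !if_same.
have Vu : invmx (basis_mx [tuple of u ++ w ++ us]) \in unitmx by rewrite
  unitmx_inv.
apply: (can_inj (mulKmx Vu)).
by apply: (can_inj (mulmxK Pu)); rewrite nf1 mulmx1 mulVmx.
Qed.

End WittNormalForm.

(* The combination td (c x - x) - tc (d x - x) has no w-component; unless the
   two sides agree it vanishes at some x, hence identically, which is absurd. *)
Lemma witt_slope (R : realType) (Q : 'M[R]_(2 + (1 + 2)))
    (G : set (aff R (2 + (1 + 2)))) (U : {vspace 'cV[R]_(2 + (1 + 2))})
    (u : 2.-tuple 'cV[R]_(2 + (1 + 2))) (w : 1.-tuple 'cV[R]_(2 + (1 + 2)))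
    (us : 2.-tuple 'cV[R]_(2 + (1 + 2))) (c d : aff R (2 + (1 + 2)))
    (xc xd : 'cV[R]_2) (tc td : R) :
    Q^T = Q -> Q \in unitmx -> complete_homogeneous_flat Q G ->
    witt_basis Q U u w us -> G c -> G d ->
    (image_mx (c.1 - 1%:M) <= U)%VS -> (image_mx (d.1 - 1%:M) <= U)%VS ->
    c.2 = xc 0 0 *: tnth u 0 + xc 1 0 *: tnth u 1 + tc *: tnth w 0 ->
    d.2 = xd 0 0 *: tnth u 0 + xd 1 0 *: tnth u 1 + td *: tnth w 0 ->
  td * form Q ((c.1 - 1%:M) *m tnth us 1) (tnth us 0) =
  tc * form Q ((d.1 - 1%:M) *m tnth us 1) (tnth us 0).
Proof.
move=> Qs Qu hG wb Gc Gd cU dU cE dE.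
have sc := linear_part_skew Qs Qu hG Gc;
  have sd := linear_part_skew Qs Qu hG Gd.
have c0 := witt_image0 Qs wb sc cU; have c1 := witt_image1 Qs wb sc cU.
have d0 := witt_image0 Qs wb sd dU; have d1 := witt_image1 Qs wb sd dU.
move: c0 c1 d0 d1.
set a := form Q _ _; set b := form Q _ _ => c0 c1 d0 d1.
apply/eqP; rewrite -subr_eq0; apply/negPn/negP => delta0.
(* The components of the combination along [u_1] and [u_0] are linear in y and z, with factors
   -delta and delta; y and z are the solutions making both vanish. *)
pose delta := td * a - tc * b.
pose y := (td * xc 1 0 - tc * xd 1 0) / delta.
pose z := - (td * xc 0 0 - tc * xd 0 0) / delta.
pose X := y *: tnth us 0 + z *: tnth us 1.
have zero : td *: disp c X + - tc *: disp d X = 0.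
  rewrite /disp /X !mulmxDr -!scalemxAr c0 c1 d0 d1 cE dE.
  apply/matrixP => i j; rewrite !mxE /y /z /delta; field.
  exact: delta0.
(* Passing from X to [X + us_1] changes the combination by [delta *: u_0], so its vanishing at both
   points forces [u_0 = 0], against the duality with [us_0]. *)
have := disp_relation_const Qu hG Gc Gd zero (X + tnth us 1).
have dispD e : disp e (X + tnth us 1) = disp e X + (e.1 - 1%:M) *m tnth us 1.
  by rewrite /disp mulmxDr addrAC.
rewrite !dispD (scalerDr _ (disp c X)) (scalerDr _ (disp d X)) addrACA zero
  add0r c1 d1 !scalerA mulNr -scalerDl.
move/eqP; rewrite scaler_eq0 (negPf delta0) /= => /eqP u0.
by have := witt_dual wb 0 0; rewrite u0 form0l eqxx => /esym/eqP;
  rewrite oner_eq0.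
Qed.

(** * The classification in dimension five *)

Theorem proposition4p10 (R : realType) (s : nat) (Q : 'M[R]_5)
    (G : set (aff R 5)) (hs : (s <= 5 - s)%N) (hQ : has_signature Q s)
    (hG : complete_homogeneous_flat Q G) :
  [/\ free_abelian G,
      (s = 0 \/ s = 1)%N -> pure_translations G
    & s = 2%N ->
      pure_translations G \/
      [/\ exists2 g, G g & g.1 <> 1%:M,
          exists2 r, (r <= 3)%N & free_abelian_of_rank G r
        & forall (k : nat) (g : 'I_k.+1 -> aff R 5),
            free_abelian_of_rank G k.+1 ->
            generates g G ->
            (g ord0).1 <> 1%:M ->
            [/\ (k.+1 <= 3)%N,
                free [seq (g i).2 | i : 'I_k.+1]
              & exists U : {vspace 'cV[R]_5},
                [/\ forall x, U_sum G x <-> x \in U,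
                    \dim U = 2%N,
                    exists (u : 2.-tuple 'cV[R]_5) (w : 1.-tuple 'cV[R]_5)
                      (us : 2.-tuple 'cV[R]_5), witt_basis Q U u w us
                  & forall (u : 2.-tuple 'cV[R]_5) (w : 1.-tuple 'cV[R]_5)
                      (us : 2.-tuple 'cV[R]_5), witt_basis Q U u w us ->
                    exists (c : 'I_k.+1 -> R) (x : 'I_k.+1 -> 'cV[R]_2)
                      (t : 'I_k.+1 -> R),
                    [/\ forall i,
                          aff_in_basis (basis_mx [tuple of u ++ w ++ us]) (g i)
                          = normal_form (c i) (x i) (t i),
                        c ord0 != 0
                      & forall i, t i = c i / c ord0 * t ord0]]]]].
Proof.
have sn : (s <= 5)%N by lia.
have s2 : (s <= 2)%N by lia.
have Qs := signature_sym hQ; have Qu := signature_unit hQ.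
have kills := linear_part_kills_translations sn hQ hG s2.
have [r [b [fb bG Gb Gb']]] := translation_basis Qu hG kills.
have Gr := free_abelian_on_basis Qu hG kills fb Gb Gb'.
split; first by exists 'I_r.
  by move=> s01; apply: (index1_pure_translations sn hQ hG); case: s01 => ->.
move=> _; have [pureG|npure] := pselect (pure_translations G); [by left|right].
have [g0 Gg0 g0_1] : exists2 g, G g & g.1 <> 1%:M.
  apply: contrapT => ng; apply: npure => g Gg; apply: contrapT => g1.
  by apply: ng; exists g.
(* These properties hold for the image of any one nonzero linear part: it contains the images of all
   the others, so it is U_G. *)
pose nice (U : {vspace 'cV[R]_5}) := [/\ totally_isotropic Q U, \dim U = 2%N,
  forall c, G c -> (image_mx (c.1 - 1%:M) <= U)%VS,
  forall c, G c -> in_orthogonal Q U c.2 & forall x, U_sum G x <-> x \in U].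
have niceP c : G c -> c.1 <> 1%:M -> nice (image_mx (c.1 - 1%:M)).
  move=> Gc c1; have c0 : c.1 - 1%:M != 0 by rewrite subr_eq0; exact/eqP.
  have sub d : G d -> (image_mx (d.1 - 1%:M) <= image_mx (c.1 - 1%:M))%VS.
    by move=> Gd; exact: (linear_part_image_sub sn hQ hG s2 Gc Gd c0).
  split=> //.
  - exact: linear_part_isotropic hQ hG _ Gc.
  - exact: (linear_part_image_dim sn hQ hG s2 Gc c0).
  - move=> d Gd _ /image_mxP[y ->].
    rewrite formC// (skewP _ _ (linear_part_skew Qs Qu hG Gc)).
    by rewrite kills// form0r oppr0.
  move=> x; split=> [[p [g [y [Gg ->]]]]|/image_mxP[y ->]].
    apply: memv_suml => i _; apply: (subvP (sub _ (Gg i))).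
    by apply/image_mxP; exists (y i).
  by exists 1, (fun=> c), (fun=> y); rewrite big_ord1.
have witt U : nice U -> exists (u : 2.-tuple 'cV[R]_5) (w : 1.-tuple 'cV[R]_5)
    (us : 2.-tuple 'cV[R]_5), witt_basis Q U u w us.
  by move=> [iU dU _ _ _]; exact: exists_witt_basis.
(* The r independent translation parts lie in the orthogonal of U, which is U plus the line of w, of
   dimension at most 2 + 1. *)
have r3 : (r <= 3)%N.
  have nU := niceP _ Gg0 g0_1; have [u [w [us wb]]] := witt _ nU.
  have [_ dU _ Uorth _] := nU; set U := image_mx _ in dU Uorth wb.
  have : (<<b>> <= U + <<w>>)%VS.
    apply/span_subvP => y /(nthP 0)[i]; rewrite size_tuple => ir <-.
    have [c Gc <-] := bG (Ordinal ir); apply/(witt_orthogonal wb); exact: Uorth.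
  move=> /dimvS; rewrite (eqP fb) size_tuple => /leq_trans; apply.
  apply: leq_trans (leq_of_leqif (dimv_add_leqif _ _)) _.
  by rewrite dU (leq_add2l 2) (leq_trans (dim_span _))// size_tuple.
split; [by exists g0|by exists r|].
move=> k g Gk gG g0n1.
(* The number of generators thus equals the length of the lattice basis, as both the rank bound and
   the independence of the translation parts require. *)
have kr := free_abelian_rank_unique Qu hG kills fb Gb Gb' Gk; subst r.
have Gg i : G (g i) by rewrite -gG; apply: sub_gen_smallest; exists i.
have nU := niceP _ (Gg ord0) g0n1; set U := image_mx _ in nU.
split=> //; first exact: (generates_free Qu hG kills fb bG gG).
exists U; have [iU dU imU Uorth Usum] := nU.
split=> //; first exact: witt.
move=> u w us wb.
have sk i := linear_part_skew Qs Qu hG (Gg i).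
have /choice [x /choice [t nf]] :=
  fun i => witt_normal_form Qs Qu wb (sk i) (imU _ (Gg i)) (Uorth _ (Gg i)).
pose c i := form Q (((g i).1 - 1%:M) *m tnth us 1) (tnth us 0).
have c0 : c ord0 != 0.
  apply/eqP => a0; apply: g0n1.
  exact: (witt_coef_eq0 Qs Qu wb (sk ord0) (imU _ (Gg ord0)) (Uorth _ (Gg
    ord0)) a0).
exists c, x, t; split=> // i; first by have [] := nf i.
have := witt_slope Qs Qu hG wb (Gg ord0) (Gg i) (imU _ (Gg _)) (imU _ (Gg _))
  (nf ord0).2 (nf i).2.
rewrite -!/(c _) => e.
by apply: (mulIf c0); rewrite e mulrAC divfK// mulrC.
Qed.
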